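(* There exist positive numbers $\{\kappa_\rho : \rho\in(0,1/2]\}$ such that for every $d\ge1$, every $\sigma>0$, every non-oblique nested pair of closed convex cones $C_1\subset C_2$ in $\mathbb{R}^d$ with $C_1\ne C_2$, and every $\rho\in(0,1/2]$, $$\inf_\psi \mathcal{E}(\psi;C_1,C_2,\epsilon)\ \ge\ \rho\qquad\text{whenever } \epsilon>0 \text{ and } \epsilon^2\le\kappa_\rho\,\sigma^2\,\delta^2_{\mathrm{OPT}}(C_1,C_2),$$ where the infimum is over all measurable tests $\psi:\mathbb{R}^d\to\{0,1\}$. In particular, one can take $\kappa_\rho = 1/14$ for all $\rho\in(0,1/2]$.
   Context: Model: one observes $y = \theta + \sigma g \in \mathbb{R}^d$, with $\theta\in\mathbb{R}^d$ unknown, $g \sim N(0,I_d)$ and $\sigma>0$ known; $\mathbb{E}_\theta$ denotes expectation under the law $N(\theta,\sigma^2 I_d)$ of $y$. For a closed convex cone $C$, $\Pi_C$ is Euclidean projection onto $C$, and $C^* = \{v : \langle v,u\rangle \le 0 \ \forall u \in C\}$ is the polar cone. $S=\{u\in\mathbb{R}^d:\|u\|_2=1\}$. A nested pair $C_1\subset C_2$ of closed convex cones is non-oblique if $\Pi_{C_1}(x) = \Pi_{C_1}(\Pi_{C_2}(x))$ for all $x\in\mathbb{R}^d$. Uniform error of a test $\psi$: $$\mathcal{E}(\psi;C_1,C_2,\epsilon) = \sup_{\theta\in C_1}\mathbb{E}_\theta[\psi(y)] + \sup_{\theta\in C_2\setminus B_2(C_1;\epsilon)}\mathbb{E}_\theta[1-\psi(y)],$$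 where $B_2(C_1;\epsilon) = \{\theta : \min_{u\in C_1}\|\theta-u\|_2\le\epsilon\}$. Geometric quantity: with $K = C_2\cap C_1^*$ and $g\sim N(0,I_d)$, $$\delta^2_{\mathrm{OPT}}(C_1,C_2) = \min\left\{\mathbb{E}\|\Pi_K g\|_2,\ \left(\frac{\mathbb{E}\|\Pi_K g\|_2}{\sup_{\eta\in K\cap S}\langle\eta,\mathbb{E}\Pi_K g\rangle}\right)^2\right\},$$ where the second term is $+\infty$ when its denominator is $0$. *)

(* Defs.v *)
From HB Require Import structures.
From mathcomp Require Import all_boot all_order all_algebra.
From mathcomp Require Import all_classical all_reals all_analysis.

Set Implicit Arguments.
Unset Strict Implicit.
Unset Printing Implicit Defensive.

Import Order.TTheory GRing.Theory Num.Theory.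
Import numFieldNormedType.Exports.

Local Open Scope classical_set_scope.
Local Open Scope ring_scope.

(* Row vectors carry the product sigma-algebra, generated by the coordinate
   maps, exactly as the library does for tuples; on 'rV[R]_d with R : realType
   it is the Borel sigma-algebra of R^d. *)
Definition measure_matrix_display : measure_display -> measure_display.
Proof. exact. Qed.

Section measurable_matrix.
Context {disp : measure_display} {T : measurableType disp} {m n : nat}.

Let coord (ij : 'I_m * 'I_n) (A : 'M[T]_(m, n)) : T := A ij.1 ij.2.

Definition matrix_measurable : set (set 'M[T]_(m, n)) :=
  <<s \bigcup_ij preimage_set_system setT (coord ij) measurable >>.

Let matrix_measurable0 : matrix_measurable set0.
Proof. exact: sigma_algebra0. Qed.

Let matrix_measurableC A : matrix_measurable A -> matrix_measurable (~` A).
Proof. exact: sigma_algebraC. Qed.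

Let matrix_measurable_bigcup (F : (set 'M[T]_(m, n))^nat) :
  (forall i, matrix_measurable (F i)) -> matrix_measurable (\bigcup_i F i).
Proof. exact: sigma_algebra_bigcup. Qed.

HB.instance Definition _ := @isMeasurable.Build (measure_matrix_display disp)
  'M[T]_(m, n) matrix_measurable
  matrix_measurable0 matrix_measurableC matrix_measurable_bigcup.

Lemma measurable_coord i j :
  measurable_fun setT (fun A : 'M[T]_(m, n) => A i j).
Proof.
move=> _ Y mY; apply: sub_sigma_algebra.
by exists (i, j) => //; exists Y.
Qed.

Lemma measurable_fun_matrix d' (U : measurableType d') (f : U -> 'M[T]_(m, n)) :
  (forall i j, measurable_fun setT (fun x => f x i j)) -> measurable_fun setT f.
Proof.
move=> mf; apply: (@measurability _ _ _ _ setT f _ erefl).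
move=> _ [_ [[i j] _ [Y mY <-]] <-].
rewrite setTI; have := mf i j measurableT Y mY.
by rewrite !setTI.
Qed.

End measurable_matrix.

Section standard_gaussian.
Context {R : realType}.
Local Open Scope ereal_scope.

Definition row_cons n (p : measurableTypeR R * 'rV[R]_n) : 'rV[R]_(1 + n) :=
  row_mx (p.1)%:M p.2.

Lemma row_cons0 n p : @row_cons n p ord0 (ord0 : 'I_n.+1) = p.1.
Proof.
rewrite /row_cons (_ : (ord0 : 'I_n.+1) = lshift n (ord0 : 'I_1)).
  by rewrite row_mxEl mxE eqxx.
exact: val_inj.
Qed.

Lemma row_consS n p (i : 'I_n) :
  @row_cons n p ord0 (lift ord0 i : 'I_n.+1) = p.2 ord0 i.
Proof.
rewrite /row_cons (_ : (lift ord0 i : 'I_n.+1) = rshift 1 i).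
  by rewrite row_mxEr.
exact: val_inj.
Qed.

Lemma measurable_row_cons n : measurable_fun setT (@row_cons n).
Proof.
apply: measurable_fun_matrix => i j; rewrite /row_cons.
case: (split_ordP j) => k ->.
- under eq_fun do rewrite row_mxEl ord1 (ord1 k) mxE eqxx mulr1n.
  exact: measurable_fst.
- under eq_fun do rewrite row_mxEr.
  exact: measurableT_comp (measurable_coord i k) measurable_snd.
Qed.

HB.instance Definition _ n :=
  isMeasurableFun.Build _ _ _ _ (@row_cons n) (@measurable_row_cons n).

(* N(0, I_n), built by prepending an independent N(0, 1) coordinate. *)
Fixpoint std_gauss (n : nat) : probability 'rV[R]_n R :=
  match n with
  | 0 => \d_(0%R : 'rV[R]_0)
  | n'.+1 => distribution (normal_prob 0 1 \x std_gauss n') (@row_cons n')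
  end.
End standard_gaussian.

(* The coordinates of std_gauss are independent standard normals. *)
Lemma std_gauss_box (R : realType) n (A : 'I_n -> set (measurableTypeR R)) :
  (forall i, measurable (A i)) ->
  (std_gauss n [set x : 'rV[R]_n | forall i, A i (x ord0 i)] =
   \prod_(i < n) normal_prob 0 1 (A i))%E.
Proof.
elim: n A => [|n IHn] A mA.
  rewrite big_ord0 /= diracE mem_set//=; by case.
rewrite big_ord_recl -IHn//= /distribution /pushforward.
rewrite -product_measure1E//; last first.
  rewrite (_ : mkset _ = \bigcap_(i in [set: 'I_n])
      (fun x : 'rV[R]_n => x ord0 i) @^-1` A (lift ord0 i)); last first.
    by apply/seteqP; split=> x /= h i => [_|]; exact: h.
  apply: fin_bigcap_measurable => // i _.
  by rewrite -[X in measurable X]setTI; exact: measurable_coord (mA _).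
congr ((_ \x _)%E _); apply/seteqP; split=> p /= h.
- split=> [|i]; first by have := h ord0; rewrite row_cons0.
  by have := h (lift ord0 i); rewrite row_consS.
- by move=> i; case: (unliftP ord0 i) h => [k|] -> [? h];
    rewrite ?row_consS ?row_cons0//; exact: h.
Qed.

Section cones.
Context {R : realType} {d : nat}.
Implicit Types (C : set 'rV[R]_d) (u v x : 'rV[R]_d).

Definition dot u v : R := (u *m v^T) ord0 ord0.

(* `|x| is the sup norm on matrices, hence a separate Euclidean norm. *)
Definition enorm x : R := Num.sqrt (dot x x).

Definition unit_sphere : set 'rV[R]_d := [set u | enorm u = 1].

Definition closed_convex_cone C : Prop :=
  [/\ C !=set0, closed C, convex_set (C : set (convex_lmodType 'rV[R]_d)) &
      forall (a : R) x, 0 <= a -> C x -> C (a *: x)].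

Definition polar C : set 'rV[R]_d := [set v | forall u, C u -> dot v u <= 0].

(* For C closed, convex and nonempty the minimizer exists and is unique, so
   [get] returns it. *)
Definition proj C x : 'rV[R]_d :=
  get [set u | C u /\ forall v, C v -> enorm (x - u) <= enorm (x - v)].

Definition non_oblique C1 C2 : Prop :=
  forall x, proj C1 x = proj C1 (proj C2 x).

(* For C closed and nonempty the infimum is attained: it is the minimum. *)
Definition dist_to C x : R := inf [set enorm (x - u) | u in C].

Definition tube C (eps : R) : set 'rV[R]_d := [set x | dist_to C x <= eps].

End cones.

Section testing.
Context {R : realType} {d : nat}.
Implicit Types (C K : set 'rV[R]_d) (th : 'rV[R]_d)
  (psi : 'rV[R]_d -> bool) (sigma eps : R).
Local Open Scope ereal_scope.

(* E_theta[f(y)], where y = theta + sigma g and g ~ N(0, I_d). *)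
Definition mean_at sigma th (f : 'rV[R]_d -> R) : \bar R :=
  'E_(std_gauss d)[fun g => f (th + sigma *: g)%R].

Definition uniform_error sigma psi C1 C2 eps : \bar R :=
  ereal_sup [set mean_at sigma th (fun y => (psi y)%:R%R) | th in C1] +
  ereal_sup [set mean_at sigma th (fun y => 1 - (psi y)%:R)%R |
              th in C2 `\` tube C1 eps].

Definition minimax_error sigma C1 C2 eps : \bar R :=
  ereal_inf [set uniform_error sigma psi C1 C2 eps |
              psi in [set psi | measurable_fun setT psi]].

(* Projections onto cones are 1-Lipschitz and vanish at 0, so the expectations
   below are finite and [fine] loses nothing. *)
Definition mean_norm_proj K : R :=
  fine 'E_(std_gauss d)[fun g => enorm (proj K g)].

Definition mean_proj K : 'rV[R]_d :=
  \row_i fine 'E_(std_gauss d)[fun g => proj K g ord0 i].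

(* K `&` unit_sphere is bounded, and nonempty when C1 != C2 is a non-oblique
   nested pair, so the real-valued [sup] is the genuine supremum. *)
Definition delta_opt2 C1 C2 : \bar R :=
  let K := C2 `&` polar C1 in
  let a := mean_norm_proj K in
  let s := sup [set dot eta (mean_proj K) | eta in K `&` unit_sphere] in
  mine a%:E (if s == 0%R then +oo else ((a / s) ^+ 2)%:E).

End testing.

(* Main.v *)
(* With K = C2 `&` polar C1, every u in K is at distance |u| from C1, so it
   suffices to test 0 against a prior supported on vectors of K of norm > eps.
   If E|Pi_K g| <= 8, a Dirac mass is enough; otherwise the prior is the law of
   tau Pi_K g conditioned on |Pi_K g| > E|Pi_K g| / 2. The second moment of its
   likelihood ratio is at most a constant times E exp(tau^2 <Pi_K g, Pi_K g'>),
   with g' an independent copy of g. As Pi_K is 1-Lipschitz, this expectation is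
   controlled by Gaussian concentration, applied first to g for fixed g' and
   then to g'; |E Pi_K g| is at most the supremum in delta_opt2 because
   E Pi_K g lies in K. Concentration is derived from Maurey's infimum-convolution
   inequality, which tensorizes; in dimension one it is an instance of the
   Prekopa-Leindler inequality, whose proof is short here since the superlevel
   sets of the Gaussian density are intervals. *)
Require Import Defs.
From HB Require Import structures.
From mathcomp Require Import all_boot all_order all_algebra.
From mathcomp Require Import all_classical all_reals all_analysis.
From mathcomp Require Import measurable_realfun ring lra.

Set Implicit Arguments.
Unset Strict Implicit.
Unset Printing Implicit Defensive.

Import Order.TTheory GRing.Theory Num.Theory.
Import numFieldNormedType.Exports.

Local Open Scope classical_set_scope.
Local Open Scope ring_scope.

(* The coordinate maps of product spaces are also called [proj]. *)
Local Notation proj := Defs.proj.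

(** * Layer cake formula and the one-dimensional Gaussian measure *)

(** A constant [kappa] serves every [rho] because the error is shown to be at least 1/2. If [chi] is
    the second moment of the normalised likelihood ratio, the argument gives error at least 1 -
    [chi] / 4, so the target is [chi <= 2]. Write [a] for the mean norm and [m] for the mean of the
    projection. When [a <= 8], [eps^2 / sigma^2] is at most 8/14 < 3/5, and a point mass at squared
    norm 3/5 has [chi] = exp (3/5) < 2. When [a >= 8], [tau = 2 eps / (sigma a)] puts the
    conditioned vectors beyond [eps], and 1/14 makes both [tau^2 a] and [tau^2 |m|^2] at most 2/7;
    conditioning costs at most a factor (16/15)^2. The obstacle is the second use of concentration:
    integrating out [g] leaves the exponent [tau^2 <m, Pi g'> + tau^4 |Pi g'|^2], which is
    quadratic, hence not Lipschitz. The infimum-convolution inequality still applies, since it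
    compares two different functions and its cost |x - y|^2 / 4 can absorb the quadratic growth. *)

Section hypograph.
Context d (T : measurableType d) (R : realType).
Local Open Scope ereal_scope.
Notation mu := (@lebesgue_measure R).

(** For [f >= 0] the vertical sections have length [f x], also when [f x = +oo], and the section at
    a level [s >= 0] is a strict superlevel set. Tonelli on the indicator thus exchanges points and
    levels, in place of approximation by simple functions. *)
Definition hypograph (f : T -> \bar R) : set (T * measurableTypeR R) :=
  [set p | (0 <= p.2)%R /\ p.2%:E < f p.1].

Lemma measurable_hypograph (f : T -> \bar R) :
  measurable_fun setT f -> measurable (hypograph f).
Proof.
move=> mf.
rewrite (_ : hypograph f = (setT `&` [set p | cst 0%E p <= (EFin \o snd) p]) `&`
                 (setT `&` [set p | (EFin \o snd) p < (f \o fst) p])); last first.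
  apply/seteqP; split=> p /=; rewrite ?lee_fin; first by case.
  by case=> -[_ ?] [_ ?].
have m2 : measurable_fun setT (EFin \o snd : T * measurableTypeR R -> \bar R).
  by apply/measurable_EFinP; exact: measurable_snd.
apply: measurableI; first exact: measurable_lee.
by apply: measurable_lte => //; exact: measurableT_comp.
Qed.

Lemma integral_hypograph (f : T -> \bar R) x :
  measurable_fun setT f -> (forall x, 0 <= f x) ->
  \int[mu]_s (\1_(hypograph f) (x, s))%:E = f x.
Proof.
move=> mf f0.
rewrite (_ : (fun s => _) =
    EFin \o \1_[set s : measurableTypeR R | hypograph f (x, s)])//.
have mAx : measurable [set s : measurableTypeR R | hypograph f (x, s)].
  have := measurable_xsection x (measurable_hypograph mf).
  by rewrite /xsection; under eq_set do rewrite inE.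
rewrite integral_indic// setIT.
have := f0 x; case fx : (f x) => [r| |]//.
- rewrite lee_fin => r0.
  rewrite (_ : [set s | _] = `[0%R, r[%classic); last first.
    apply/seteqP; split=> s; rewrite /hypograph /= fx lte_fin in_itv/=.
      by case=> -> ->.
    by case/andP.
  rewrite /= lebesgue_measure_itv/= lte_fin.
  case: ltP => [_|r0']; first by rewrite -EFinB subr0.
  by congr (_%:E); apply/eqP; rewrite eq_le r0 r0'.
- move=> _; rewrite (_ : [set s | _] = `[0%R, +oo[%classic); last first.
    by apply/seteqP; split=> s; rewrite /hypograph /= fx ltry in_itv/= andbT//; case.
  by rewrite /= lebesgue_measure_itv/= ltry.
Qed.

Lemma layer_cake (m : {sigma_finite_measure set T -> \bar R}) (f : T -> \bar R) :
  measurable_fun setT f -> (forall x, 0 <= f x) ->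
  \int[m]_x f x = \int[mu]_(s in `[0%R, +oo[) m [set x | s%:E < f x].
Proof.
move=> mf f0.
under eq_integral do rewrite -integral_hypograph//.
rewrite (fubini_tonelli (fun p => (\1_(hypograph f) p)%:E))//=; last first.
  apply/measurable_EFinP; apply: measurable_indic.
  exact: measurable_hypograph.
rewrite [RHS]integral_mkcond; apply: eq_integral => s _; rewrite patchE.
case: ifPn => [|]; rewrite ?notin_setE ?inE/= in_itv/= andbT => s0.
  rewrite (_ : (fun x => _) = EFin \o \1_[set x | s%:E < f x]); last first.
    apply/funext => x /=; rewrite !indicE; congr (_%:R)%:E; congr nat_of_bool.
    by apply/asbool_equiv_eq; split => [[]|].
  rewrite integral_indic ?setIT// -[X in measurable X]setTI.
  exact: emeasurable_fun_o_infty.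
apply: integral0_eq => x _; rewrite indicE memNset// => -[] /= s0'.
by case: (s0).
Qed.

End hypograph.

Section gaussian1.
Context {R : realType}.
Local Open Scope ereal_scope.
Notation mu := (@lebesgue_measure R).
Notation N1 := (@normal_prob R 0 1).

(** Slicing [f] into levels reduces the identity to superlevel sets, where it is the definition of
    [normal_prob]; a second use of Tonelli reassembles [f]. *)
Lemma integral_normal_prob (m sd : R) (f : measurableTypeR R -> \bar R) :
  measurable_fun setT f -> (forall x, 0 <= f x) ->
  \int[normal_prob m sd]_x f x = \int[mu]_x (f x * (normal_pdf m sd x)%:E).
Proof.
move=> mf f0; pose A := hypograph f.
have mA : measurable A by exact: measurable_hypograph.
have mp : measurable_fun setT (fun x : measurableTypeR R => (normal_pdf m sd x)%:E).
  by apply/measurable_EFinP; exact: measurable_normal_pdf.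
have p0 x : 0 <= (normal_pdf m sd x)%:E by rewrite lee_fin normal_pdf_ge0.
have mI : measurable_fun setT (fun p => (\1_A p : R)%:E).
  by apply/measurable_EFinP; exact: measurable_indic.
have mIy y : measurable_fun setT (fun x => (\1_A (x, y) : R)%:E).
  by apply: (measurableT_comp mI); exact: pair2_measurable.
have mIx x : measurable_fun setT (fun y => (\1_A (x, y) : R)%:E).
  by apply: (measurableT_comp mI); exact: pair1_measurable.
transitivity (\int[mu]_s \int[mu]_x ((\1_A (x, s))%:E * (normal_pdf m sd x)%:E)).
  under [LHS]eq_integral do rewrite -integral_hypograph//.
  etransitivity.
    exact: (@fubini_tonelli _ _ _ _ _ (normal_prob m sd) mu (fun p => (\1_A p)%:E)).
  apply: eq_integral => s _.
  have mAs : measurable [set x : measurableTypeR R | A (x, s)].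
    have := measurable_ysection s mA.
    by rewrite /ysection; under eq_set do rewrite inE.
  have Es x : (\1_A (x, s) = \1_[set x | A (x, s)] x :> R)%R.
    by [].
  under eq_integral do rewrite Es.
  rewrite integral_indic//= setIT /normal_prob.
  rewrite [LHS]integral_mkcond; apply: eq_integral => x _.
  rewrite patchE Es indicE /=.
  by case: ifPn => _; rewrite ?mul1e ?mul0e.
rewrite -(fubini_tonelli (fun p => (\1_A p)%:E * (normal_pdf m sd p.1)%:E))//=.
- apply: eq_integral => x _.
  by rewrite ge0_integralZr// integral_hypograph.
- apply: emeasurable_funM => //; apply: (measurableT_comp mp); exact: measurable_fst.
- by move=> p; rewrite mule_ge0.
Qed.

Lemma lebesgue_integral_shift (f : measurableTypeR R -> \bar R) (t : R) :
  measurable_fun setT f -> (forall x, 0 <= f x) ->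
  \int[mu]_x f (x + t)%R = \int[mu]_x f x.
Proof.
move=> mf f0.
pose tr (x : measurableTypeR R) : measurableTypeR R := (x + t)%R.
have mt : measurable_fun setT tr by exact: measurable_funD.
transitivity (\int[pushforward mu tr]_x f x).
  by rewrite ge0_integral_pushforward.
apply: eq_measure_integral => A mA _; apply/esym.
apply: lebesgue_measure_unique => // _ [[a b]] _ <-.
rewrite [RHS](_ : _ = mu `](a - t)%R, (b - t)%R]%classic); last first.
  by congr (mu _); apply/seteqP; split=> x /=; rewrite !in_itv/= ltrBlDr lerBrDr.
by rewrite /= !lebesgue_measure_itv/= !lte_fin ltrBlDr subrK -!EFinD opprB addrA subrK.
Qed.

Lemma normal_pdf01E x : normal_pdf 0 1 x =
  (normal_peak 1 * expR (- x ^+ 2 / 2) :> R)%R.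
Proof. by rewrite normal_pdfE ?oner_eq0// /normal_fun subr0 expr1n. Qed.

(** One-dimensional Cameron-Martin formula: translate Lebesgue measure by [- t] and expand the
    square in the density. *)
Lemma normal_prob_shift (f : measurableTypeR R -> \bar R) (t : R) :
  measurable_fun setT f -> (forall x, 0 <= f x) ->
  \int[N1]_x f (t + x)%R = \int[N1]_x (f x * (expR (t * x - t ^+ 2 / 2))%:E).
Proof.
move=> mf f0.
have mt : measurable_fun setT
    (fun x : measurableTypeR R => (t + x)%R : measurableTypeR R).
  exact: measurable_funD.
have mp : measurable_fun setT (fun x : measurableTypeR R => (normal_pdf 0 1 x)%:E).
  by apply/measurable_EFinP; exact: measurable_normal_pdf.
rewrite integral_normal_prob//; last exact: (measurableT_comp mf).
rewrite integral_normal_prob//; last 2 first.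
- apply: emeasurable_funM => //; apply/measurable_EFinP.
  by apply: measurableT_comp => //; apply: measurable_funB.
- by move=> x; rewrite mule_ge0// lee_fin expR_ge0.
rewrite -(@lebesgue_integral_shift _ (- t)); last 2 first.
- apply: emeasurable_funM; last exact: mp.
  exact: (measurableT_comp mf).
- by move=> x; rewrite mule_ge0// lee_fin normal_pdf_ge0.
apply: eq_integral => x _; rewrite addrC subrK -muleA -EFinM.
congr (_ * _%:E); rewrite !normal_pdf01E mulrCA -expRD; congr (_ * expR _)%R.
by field.
Qed.

End gaussian1.

(** * Infimum-convolution inequality in dimension one *)

Section prekopa_leindler.
Context {R : realType}.
Local Open Scope ereal_scope.
Notation mu := (@lebesgue_measure R).

(** One-dimensional Brunn-Minkowski. As [I] is an interval, it contains everything between two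
    midpoints, so its length controls the widths of [A] and [B], and these bound the measures. *)
Lemma lebesgue_measure_midpoints (A B I : set R) :
  measurable A -> measurable B -> measurable I -> is_interval I ->
  A !=set0 -> B !=set0 ->
  (forall x y, A x -> B y -> I ((x + y) / 2)%R) ->
  mu A + mu B <= mu I + mu I.
Proof.
move=> mA mB mI itvI [a Aa] [b Bb] AB.
have [Ioo|] := eqVneq (mu I) +oo; first by rewrite Ioo leey.
rewrite -ltey -ge0_fin_numE// => Ifin.
pose L := fine (mu I).
have IE : mu I = L%:E by rewrite /L fineK.
(* The segment between two midpoints lies in [I], so its length is at most [L]. Fixing points of one
   set then bounds the other, so all four extrema below are genuine. *)
have key x1 x2 y1 y2 : A x1 -> A x2 -> B y1 -> B y2 ->
    (x2 + y2 <= L + L + x1 + y1)%R.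
  move=> A1 A2 B1 B2.
  have L0 : (0 <= L)%R by rewrite /L fine_ge0.
  have [z12|] := leP ((x1 + y1) / 2)%R ((x2 + y2) / 2)%R; last by lra.
  have : mu `[((x1 + y1) / 2)%R, ((x2 + y2) / 2)%R]%classic <= mu I.
    apply: le_measure; rewrite ?inE//= => z /=; rewrite in_itv/= => /andP[z1 z2].
    by apply: (itvI _ _ (AB _ _ A1 B1) (AB _ _ A2 B2)); rewrite z1 z2.
  rewrite lebesgue_measure_itv/= lte_fin IE.
  case: ltP => [_|z21 _]; last by move: z21 z12; lra.
  by rewrite -EFinB lee_fin; lra.
have supA : has_sup A.
  split; first by exists a.
  by exists (L + L + a + b - b)%R => x Ax; have := key a x b b Aa Ax Bb Bb; lra.
have infA : has_inf A.
  split; first by exists a.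
  by exists (a + b - (L + L) - b)%R => x Ax; have := key x a b b Ax Aa Bb Bb; lra.
have supB : has_sup B.
  split; first by exists b.
  by exists (L + L + a + b - a)%R => y By; have := key a a b y Aa Aa Bb By; lra.
have infB : has_inf B.
  split; first by exists b.
  by exists (a + b - (L + L) - a)%R => y By; have := key a a y b Aa Aa By Bb; lra.
(* The four points of [key] are replaced by extrema one at a time. *)
have spread : (sup A - inf A + (sup B - inf B) <= L + L)%R.
  have h1 x1 y1 y2 : A x1 -> B y1 -> B y2 -> (sup A + y2 <= L + L + x1 + y1)%R.
    move=> A1 B1 B2; rewrite -lerBrDr; apply: ge_sup; first by exists a.
    by move=> x Ax; rewrite lerBrDr; exact: key.
  have h2 x1 y1 : A x1 -> B y1 -> (sup A + sup B <= L + L + x1 + y1)%R.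
    move=> A1 B1; rewrite addrC -lerBrDr; apply: ge_sup; first by exists b.
    by move=> y By; rewrite lerBrDr addrC; exact: h1.
  have h3 y1 : B y1 -> (sup A + sup B - (L + L) - y1 <= inf A)%R.
    move=> B1; apply: lb_le_inf; first by exists a.
    by move=> x Ax; have := h2 x y1 Ax B1; lra.
  have : (sup A + sup B - (L + L) - inf A <= inf B)%R.
    apply: lb_le_inf; first by exists b.
    by move=> y By; have := h3 y By; lra.
  by lra.
have width (S : set R) : measurable S -> has_sup S -> has_inf S ->
    mu S <= (sup S - inf S)%:E.
  move=> mS supS infS.
  apply: (@le_trans _ _ (mu `[inf S, sup S]%classic)).
    apply: le_measure; rewrite ?inE//= => x Sx /=; rewrite in_itv/=.
    by rewrite ge_inf ?ub_le_sup//; [case: supS|case: infS].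
  rewrite lebesgue_measure_itv/= lte_fin; case: ltP => // h.
  rewrite lee_fin subr_ge0; case: supS => -[x Sx] us; case: infS => _ is_.
  by rewrite (@le_trans _ _ x)// ?ge_inf// ub_le_sup.
apply: (le_trans (leeD (width _ mA supA infA) (width _ mB supB infB))).
by rewrite IE -!EFinD lee_fin.
Qed.

(** With both suprema equal to 1, the superlevel sets of [u] and [v] are nonempty for the same
    levels [s < 1]. The midpoint inequality then applies level by level, and the layer cake formula
    sums it into an additive bound, which implies the multiplicative one. *)
Lemma prekopa_leindler_unit (u v w : measurableTypeR R -> R) :
  measurable_fun setT u -> measurable_fun setT v -> measurable_fun setT w ->
  (forall x, (0 <= u x <= 1)%R) -> (forall x, (0 <= v x <= 1)%R) ->
  (forall x, (0 <= w x)%R) ->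
  (forall s, (s < 1)%R -> exists x, (s < u x)%R) ->
  (forall s, (s < 1)%R -> exists x, (s < v x)%R) ->
  (forall s, is_interval [set x | (s < w x)%R]) ->
  (forall x y, (u x * v y <= w ((x + y) / 2) ^+ 2)%R) ->
  \int[mu]_x (u x)%:E + \int[mu]_x (v x)%:E <=
  \int[mu]_x (w x)%:E + \int[mu]_x (w x)%:E.
Proof.
move=> mu_ mv mw u01 v01 w0 supu supv itvw uvw.
have lc (f : measurableTypeR R -> R) : measurable_fun setT f ->
    (forall x, (0 <= f x)%R) -> \int[mu]_x (f x)%:E =
    \int[mu]_(s in `[0%R, +oo[) mu [set x | (s < f x)%R].
  move=> mf f0; rewrite layer_cake//; exact/measurable_EFinP.
have mlev (f : measurableTypeR R -> R) s : measurable_fun setT f ->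
    measurable [set x | (s < f x)%R].
  move=> mf; rewrite -[X in measurable X]setTI.
  have /measurable_EFinP mf' := mf.
  exact: (emeasurable_fun_o_infty _ mf' s%:E).
have mint (f : measurableTypeR R -> R) : measurable_fun setT f ->
    measurable_fun (`[0%R, +oo[%classic : set R) (fun s => mu [set x | (s < f x)%R]).
  move=> mf; have /measurable_EFinP mf' := mf.
  apply: (eq_measurable_fun (mu \o ysection (hypograph (EFin \o f)))).
    move=> s; rewrite inE/= in_itv/= andbT => s0; congr (mu _).
    apply/seteqP; split=> x; rewrite /ysection/= inE /hypograph/= lte_fin //.
    by case.
  apply: measurable_funTS; apply: measurable_fun_ysection.
  exact: measurable_hypograph.
rewrite !lc//; [|by move=> x; have /andP[] := v01 x|by move=> x; have /andP[] := u01 x].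
rewrite -!ge0_integralD//; try exact: mint.
apply: ge0_le_integral => //.
- by move=> s _; rewrite adde_ge0.
- by apply: emeasurable_funD; exact: mint.
- by apply: emeasurable_funD; exact: mint.
move=> s; rewrite /= in_itv/= andbT => s0.
have [s1|s1] := ltP s 1%R.
  apply: lebesgue_measure_midpoints; [exact: mlev..|exact: itvw| | |].
  - exact: supu.
  - exact: supv.
  - move=> x y /= sx sy.
    rewrite -(@ltr_pXn2r _ 2)// ?nnegrE//.
    by rewrite (lt_le_trans _ (uvw x y))// expr2 ltr_pM.
rewrite (_ : [set x | (s < u x)%R] = set0); last first.
  by rewrite -subset0 => x /=; have /andP[_] := u01 x; lra.
rewrite (_ : [set x | (s < v x)%R] = set0); last first.
  by rewrite -subset0 => x /=; have /andP[_] := v01 x; lra.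
by rewrite measure0 adde0 adde_ge0.
Qed.


Lemma is_interval_normal_pdf01 (s : R) :
  is_interval [set x | (s < normal_pdf 0 1 x)%R].
Proof.
move=> x y /= sx sy z /andP[xz zy].
have [z0|z0] := leP 0%R z.
  apply: (lt_le_trans sy); rewrite !normal_pdf01E ler_wpM2l ?normal_peak_ge0//.
  by rewrite ler_expR; nra.
apply: (lt_le_trans sx); rewrite !normal_pdf01E ler_wpM2l ?normal_peak_ge0//.
by rewrite ler_expR; nra.
Qed.

(** Reduction to suprema equal to 1, followed by the arithmetic-geometric mean inequality. The
    suprema are finite because [u x * v y] is bounded by the squared peak of the density, and one
    factor can be frozen at a positive value. *)
Lemma prekopa_leindler_gauss (u v : measurableTypeR R -> R) :
  measurable_fun setT u -> measurable_fun setT v ->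
  (forall x, 0 <= u x)%R -> (forall x, 0 <= v x)%R ->
  (forall x y, (u x * v y <= normal_pdf 0 1 ((x + y) / 2) ^+ 2)%R) ->
  \int[mu]_x (u x)%:E * \int[mu]_x (v x)%:E <= 1.
Proof.
move=> mu_ mv u0 v0 uvw.
have int0 (f : measurableTypeR R -> R) : (forall x, f x = 0)%R ->
    \int[mu]_x (f x)%:E = 0.
  by move=> f0; apply: integral0_eq => x _; rewrite f0.
have [/int0->|/existsNP[x0 /eqP ux0]] := pselect (forall x, u x = 0%R).
  by rewrite mul0e.
have [/int0->|/existsNP[y0 /eqP vy0]] := pselect (forall x, v x = 0%R).
  by rewrite mule0.
have {}ux0 : (0 < u x0)%R by rewrite lt_def ux0 u0.
have {}vy0 : (0 < v y0)%R by rewrite lt_def vy0 v0.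
pose P := @normal_peak R 1.
have uvP x y : (u x * v y <= P ^+ 2)%R.
  apply: (le_trans (uvw x y)).
  by rewrite ler_pXn2r// ?nnegrE ?normal_pdf_ge0 ?normal_peak_ge0// normal_pdf_ub.
have bu : has_sup (range u).
  split; first by exists (u x0), x0.
  by exists (P ^+ 2 / v y0)%R => _ [x _ <-]; rewrite ler_pdivlMr.
have bv : has_sup (range v).
  split; first by exists (v y0), y0.
  by exists (P ^+ 2 / u x0)%R => _ [x _ <-]; rewrite ler_pdivlMr// mulrC.
pose M := sup (range u); pose N := sup (range v).
have uM x : (u x <= M)%R by apply: ub_le_sup; [case: bu|exists x].
have vN x : (v x <= N)%R by apply: ub_le_sup; [case: bv|exists x].
have M0 : (0 < M)%R by rewrite (lt_le_trans ux0).
have N0 : (0 < N)%R by rewrite (lt_le_trans vy0).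
(* The geometric mean is the scale for the density that preserves the hypothesis when [u] and [v]
   are divided by [M] and [N]. *)
pose q := Num.sqrt (M * N).
have q0 : (0 < q)%R by rewrite sqrtr_gt0 mulr_gt0.
have q2 : (q ^+ 2 = M * N)%R by rewrite sqr_sqrtr// ltW// mulr_gt0.
have near_sup (f : measurableTypeR R -> R) (s : R) : has_sup (range f) ->
    (0 < sup (range f))%R -> (s < 1)%R ->
    exists x, (s < f x / sup (range f))%R.
  move=> bf f0 s1; have e0 : (0 < sup (range f) * (1 - s))%R.
    by rewrite mulr_gt0// subr_gt0.
  have [_ [x _ <-] h] := sup_adherent e0 bf.
  by exists x; rewrite ltr_pdivlMr//; move: h; lra.
have mw : measurable_fun setT (normal_pdf 0 1 : measurableTypeR R -> R).
  exact: measurable_normal_pdf.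
have := @prekopa_leindler_unit (fun x => u x / M)%R (fun x => v x / N)%R
  (fun x => normal_pdf 0 1 x / q)%R.
have mdiv (f : measurableTypeR R -> R) (c : R) : measurable_fun setT f ->
    measurable_fun setT (fun x => f x / c)%R.
  by move=> mf; apply: measurable_funM.
have intdiv (f : measurableTypeR R -> R) (c : R) : measurable_fun setT f ->
    (forall x, 0 <= f x)%R -> (0 < c)%R ->
    \int[mu]_x (f x)%:E = c%:E * \int[mu]_x (f x / c)%:E.
  move=> mf f0 c0; rewrite -ge0_integralZl//; last 3 first.
  - by apply/measurable_EFinP; exact: mdiv.
  - by move=> x _; rewrite lee_fin divr_ge0// ltW.
  - by rewrite lee_fin ltW.
  by apply: eq_integral => x _; rewrite -EFinM mulrC divfK// gt_eqF.
move=> /(_ (mdiv _ _ mu_) (mdiv _ _ mv) (mdiv _ _ mw)) PL.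
rewrite (intdiv u M)// (intdiv v N)//.
have := intdiv _ q mw (normal_pdf_ge0 0 1) q0.
rewrite integral_normal_pdf.
set W := \int[mu]_x (normal_pdf 0 1 x / q)%:E => qW.
have WE : W = q^-1%:E.
  by rewrite -[W]mul1e -(@mulVf _ q) ?gt_eqF// EFinM -muleA -qW mule1.
have {PL} : \int[mu]_x (u x / M)%:E + \int[mu]_x (v x / N)%:E <= W + W.
  apply: PL.
  - by move=> x; rewrite divr_ge0 ?(ltW M0)//= ler_pdivrMr// mul1r.
  - by move=> x; rewrite divr_ge0 ?(ltW N0)//= ler_pdivrMr// mul1r.
  - by move=> x; rewrite divr_ge0 ?normal_pdf_ge0// ltW.
  - by move=> s; exact: near_sup.
  - by move=> s; exact: near_sup.
  - move=> s; have := @is_interval_normal_pdf01 (s * q)%R.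
    by under eq_set do rewrite -ltr_pdivlMr//.
  - move=> x y; rewrite mulf_div expr_div_n q2.
    by rewrite ler_wpM2r ?invr_ge0 ?mulr_ge0// ltW.
rewrite WE -EFinD.
have U0 : 0 <= \int[mu]_x (u x / M)%:E.
  by apply: integral_ge0 => x _; rewrite lee_fin divr_ge0// ltW.
have V0 : 0 <= \int[mu]_x (v x / N)%:E.
  by apply: integral_ge0 => x _; rewrite lee_fin divr_ge0// ltW.
move: U0 V0; set U := integral _ _ _; set V := integral _ _ _.
case: U => [U| |]//; case: V => [V| |]//.
rewrite -EFinD -!EFinM !lee_fin => U0 V0 UV.
have -> : (M * U * (N * V) = q ^+ 2 * (U * V))%R by rewrite q2; ring.
have : (q * U + q * V <= 2)%R.
  have := ler_wpM2l (ltW q0) UV.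
  by rewrite mulrDr mulrDr !mulfV ?gt_eqF//; lra.
(* A sum [q * U + q * V] of at most 2 forces a product of at most 1. *)
have : (0 <= (q * U - q * V) ^+ 2)%R by exact: sqr_ge0.
have : (0 <= q * U)%R by rewrite mulr_ge0// ltW.
have : (0 <= q * V)%R by rewrite mulr_ge0// ltW.
by nra.
Qed.

(* With f = log A and g = - log B, the hypothesis reads
   f(x) <= g(y) + |x - y|^2 / 4, which tensorizes. *)
Lemma normal_prob_infconv (A B : measurableTypeR R -> \bar R) :
  measurable_fun setT A -> measurable_fun setT B ->
  (forall x, 0 <= A x) -> (forall x, 0 <= B x) ->
  (forall x y, A x * B y <= (expR ((x - y) ^+ 2 / 4))%:E) ->
  \int[normal_prob 0 1]_x A x * \int[normal_prob 0 1]_x B x <= 1.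
Proof.
move=> mA mB A0 B0 AB.
(* An infinite value of one function, together with a finite bound on the product, forces the other
   function to vanish; the convention [+oo * 0 = 0] then settles the product of integrals. *)
have degenerate (f g : measurableTypeR R -> \bar R) x0 :
    (forall x, 0 <= g x) -> (forall x y, f x * g y < +oo) -> f x0 = +oo ->
    \int[normal_prob 0 1]_x g x = 0.
  move=> g0 fg fx0; apply: integral0_eq => y _.
  have := fg x0 y; rewrite fx0; have := g0 y.
  rewrite le_eqVlt => /predU1P[//|gy]; by rewrite gt0_mulye.
have [[x Ax]|/forallNP Afin] := pselect (exists x, A x = +oo).
  rewrite (degenerate A B x) ?mule0// => a b.
  by rewrite (le_lt_trans (AB a b))// ltry.
have [[y By]|/forallNP Bfin] := pselect (exists y, B y = +oo).
  rewrite (degenerate B A y) ?mul0e// => a b.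
  by rewrite muleC (le_lt_trans (AB b a))// ltry.
rewrite !integral_normal_prob//.
have AE x : A x = (fine (A x))%:E.
  by rewrite fineK// ge0_fin_numE// ltey; apply/eqP/Afin.
have BE x : B x = (fine (B x))%:E.
  by rewrite fineK// ge0_fin_numE// ltey; apply/eqP/Bfin.
under eq_integral do rewrite AE -EFinM.
under [X in _ * X]eq_integral do rewrite BE -EFinM.
have mp : measurable_fun setT (normal_pdf 0 1 : measurableTypeR R -> R).
  exact: measurable_normal_pdf.
apply: prekopa_leindler_gauss.
- by apply: measurable_funM => //; exact: measurableT_comp.
- by apply: measurable_funM => //; exact: measurableT_comp.
- by move=> x; rewrite mulr_ge0 ?normal_pdf_ge0 ?fine_ge0.
- by move=> x; rewrite mulr_ge0 ?normal_pdf_ge0 ?fine_ge0.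
move=> x y; rewrite mulrACA.
have := AB x y; rewrite AE BE -EFinM lee_fin => ABxy.
have pp : (0 <= normal_pdf 0 1 x * normal_pdf 0 1 y :> R)%R.
  by rewrite mulr_ge0 ?normal_pdf_ge0.
apply: (le_trans (ler_wpM2r pp ABxy)).
(* The cost is calibrated by the parallelogram identity x^2 / 2 + y^2 / 2 - (x - y)^2 / 4 = ((x + y)
   / 2)^2, so equality holds here. *)
rewrite !normal_pdf01E exprMn -expRM_natl.
rewrite [leLHS](_ : _ = normal_peak 1 ^+ 2 * (expR ((x - y) ^+ 2 / 4) *
  expR (- x ^+ 2 / 2) * expR (- y ^+ 2 / 2)))%R; last by ring.
rewrite -!expRD ler_wpM2l ?sqr_ge0// ler_expR le_eqVlt; apply/orP; left.
by apply/eqP; field.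
Qed.

End prekopa_leindler.

(** * Standard Gaussian measure in dimension d *)

Section dot.
Context {R : realType} {d : nat}.
Implicit Types u v w : 'rV[R]_d.

Lemma dotE u v : dot u v = \sum_i u ord0 i * v ord0 i.
Proof. by rewrite /dot mxE; apply: eq_bigr => i _; rewrite mxE. Qed.

Lemma dotC u v : dot u v = dot v u.
Proof. by rewrite !dotE; apply: eq_bigr => i _; rewrite mulrC. Qed.

Lemma dotDl u v w : dot (u + v) w = dot u w + dot v w.
Proof. by rewrite /dot mulmxDl mxE. Qed.

Lemma dotDr u v w : dot w (u + v) = dot w u + dot w v.
Proof. by rewrite dotC dotDl !(dotC w). Qed.

Lemma dotZl a u v : dot (a *: u) v = a * dot u v.
Proof. by rewrite /dot -scalemxAl mxE. Qed.

Lemma dotZr a u v : dot u (a *: v) = a * dot u v.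
Proof. by rewrite dotC dotZl dotC. Qed.

Lemma dotNl u v : dot (- u) v = - dot u v.
Proof. by rewrite -scaleN1r dotZl mulN1r. Qed.

Lemma dotNr u v : dot u (- v) = - dot u v.
Proof. by rewrite dotC dotNl dotC. Qed.

Lemma dotBl u v w : dot (u - v) w = dot u w - dot v w.
Proof. by rewrite dotDl dotNl. Qed.

Lemma dotBr u v w : dot w (u - v) = dot w u - dot w v.
Proof. by rewrite dotDr dotNr. Qed.

Lemma dot0l u : dot 0 u = 0.
Proof. by rewrite -(scale0r 0) dotZl mul0r. Qed.

Lemma dot0r u : dot u 0 = 0.
Proof. by rewrite dotC dot0l. Qed.

Lemma dot_ge0 u : 0 <= dot u u.
Proof. by rewrite dotE sumr_ge0// => i _; rewrite -expr2 sqr_ge0. Qed.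

Lemma dot_eq0 u : (dot u u == 0) = (u == 0).
Proof.
apply/idP/eqP => [|->]; last by rewrite dot0l.
rewrite dotE psumr_eq0 => [/allP h|i _]; last by rewrite -expr2 sqr_ge0.
apply/rowP => i; rewrite mxE; apply/eqP.
by have := h i; rewrite mem_index_enum -expr2 sqrf_eq0; apply.
Qed.

End dot.

Lemma eq_row_cons (R : realType) n (u v : 'rV[R]_n.+1) :
  u ord0 ord0 = v ord0 ord0 ->
  (forall i : 'I_n, u ord0 (lift ord0 i) = v ord0 (lift ord0 i)) -> u = v.
Proof.
move=> uv0 uvS; apply/rowP => i.
by case: (unliftP ord0 i) => [j|] ->; [exact: uvS|exact: uv0].
Qed.

Lemma row_consE (R : realType) n (x : 'rV[R]_n.+1) :
  x = row_cons (x ord0 ord0, (\row_(i < n) x ord0 (lift ord0 i) : 'rV[R]_n))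
    :> 'rV[R]_n.+1.
Proof.
by apply: eq_row_cons => [|i]; rewrite ?row_cons0 ?row_consS/= ?mxE.
Qed.

Lemma row_consD (R : realType) n (a b : R) (u v : 'rV[R]_n) :
  row_cons (a, u) + row_cons (b, v) = row_cons (a + b, u + v) :> 'rV[R]_n.+1.
Proof.
by apply: eq_row_cons => [|i]; rewrite mxE ?row_cons0 ?row_consS/= ?mxE.
Qed.

Lemma row_consB (R : realType) n (a b : R) (u v : 'rV[R]_n) :
  row_cons (a, u) - row_cons (b, v) = row_cons (a - b, u - v) :> 'rV[R]_n.+1.
Proof.
by apply: eq_row_cons => [|i]; rewrite mxE [X in _ + X]mxE ?row_cons0 ?row_consS/= ?mxE.
Qed.

Lemma dot_row_cons (R : realType) n (a b : R) (u v : 'rV[R]_n) :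
  @dot R n.+1 (row_cons (a, u)) (row_cons (b, v)) = a * b + dot u v.
Proof.
rewrite !dotE big_ord_recl !row_cons0; congr (_ + _).
by apply: eq_bigr => i _; rewrite !row_consS.
Qed.

Section measurable_rV.
Context {R : realType} {d : nat} {dU : measure_display} {U : measurableType dU}.
Implicit Types f g : U -> 'rV[R]_d.

Lemma measurable_rVP f :
  (forall i, measurable_fun setT (fun x => f x ord0 i)) -> measurable_fun setT f.
Proof. by move=> mf; apply: measurable_fun_matrix => i j; rewrite ord1. Qed.

Lemma measurable_rV_coord f i :
  measurable_fun setT f -> measurable_fun setT (fun x => f x ord0 i).
Proof. by move=> mf; exact: (measurableT_comp (measurable_coord ord0 i) mf). Qed.

Lemma measurable_dot f g : measurable_fun setT f -> measurable_fun setT g ->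
  measurable_fun setT (fun x => dot (f x) (g x)).
Proof.
move=> mf mg; under eq_fun do rewrite dotE.
apply: measurable_sum => i.
by apply: measurable_funM; exact: measurable_rV_coord.
Qed.

Lemma measurable_rV_add f g : measurable_fun setT f -> measurable_fun setT g ->
  measurable_fun setT (fun x => f x + g x).
Proof.
move=> mf mg; apply: measurable_rVP => i; under eq_fun do rewrite mxE.
by apply: measurable_funD; exact: measurable_rV_coord.
Qed.

Lemma measurable_rV_scale (a : R) f : measurable_fun setT f ->
  measurable_fun setT (fun x => a *: f x).
Proof.
move=> mf; apply: measurable_rVP => i; under eq_fun do rewrite mxE.
by apply: measurable_funM => //; exact: measurable_rV_coord.
Qed.

End measurable_rV.

(** * Translation formula and tensorization of the infimum-convolution inequality *)

Section std_gauss_theory.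
Context {R : realType}.
Local Open Scope ereal_scope.

Lemma integral_std_gaussS n (f : 'rV[R]_n.+1 -> \bar R) :
  measurable_fun setT f -> (forall x, 0 <= f x) ->
  \int[std_gauss n.+1]_x f x =
  \int[normal_prob 0 1]_x \int[std_gauss n]_v f (row_cons (x, v)).
Proof.
move=> mf f0.
transitivity (\int[(normal_prob 0 1 \x std_gauss n)]_p f (row_cons p)).
  exact: ge0_integral_distribution.
apply: (fubini_tonelli1 (f \o @row_cons R n)); last by move=> p; exact: f0.
exact: (measurableT_comp mf (@measurable_row_cons R n)).
Qed.

Lemma measurable_integral_row_cons n (f : 'rV[R]_n.+1 -> \bar R) :
  measurable_fun setT f -> (forall x, 0 <= f x) ->
  measurable_fun setT (fun x : measurableTypeR R =>
    \int[std_gauss n]_v f (row_cons (x, v))).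
Proof.
move=> mf f0.
apply: (measurable_fun_fubini_tonelli_F (m2 := std_gauss n)
  (f \o @row_cons R n)); last by move=> p; exact: f0.
exact: (measurableT_comp mf (@measurable_row_cons R n)).
Qed.

Lemma measurable_row_cons_snd n (f : 'rV[R]_n.+1 -> \bar R) (x : R) :
  measurable_fun setT f ->
  measurable_fun setT (fun v : 'rV[R]_n => f (row_cons (x, v))).
Proof.
move=> mf; apply: (measurableT_comp mf).
apply: (measurableT_comp (@measurable_row_cons R n)).
exact: pair1_measurable.
Qed.

(** Cameron-Martin formula in dimension [d], by splitting off the first coordinate; the exponent is
    additive over coordinates. *)
Lemma std_gauss_shift d (th : 'rV[R]_d) (f : 'rV[R]_d -> \bar R) :
  measurable_fun setT f -> (forall x, 0 <= f x) ->
  \int[std_gauss d]_g f (th + g)%R =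
  \int[std_gauss d]_g (f g * (expR (dot th g - dot th th / 2))%:E).
Proof.
have mexp n (t : 'rV[R]_n) : measurable_fun setT
    (fun g : 'rV[R]_n => (expR (dot t g - dot t t / 2))%:E).
  apply/measurable_EFinP; apply: measurableT_comp => //.
  by apply: measurable_funB => //; exact: measurable_dot.
elim: d th f => [|n IHn] th f mf f0.
  rewrite /= !integral_dirac//; last 2 first.
    by apply: emeasurable_funM => //; exact: mexp.
    by apply: (measurableT_comp mf); exact: measurable_rV_add.
  rewrite diracT !mul1e.
  by rewrite [th]thinmx0 dot0l mul0r subr0 expR0 mule1 addr0.
rewrite integral_std_gaussS//; last first.
  by apply: (measurableT_comp mf); exact: measurable_rV_add.
rewrite integral_std_gaussS//; last 2 first.
- by apply: emeasurable_funM => //; exact: mexp.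
- by move=> x; rewrite mule_ge0// lee_fin expR_ge0.
rewrite (row_consE th); set t := th _ _; set s := \row_i _.
pose F (x : measurableTypeR R) := \int[std_gauss n]_v
  (f (row_cons (x, v)) * (expR (dot s v - dot s s / 2))%:E).
have F0 x : 0 <= F x.
  by apply: integral_ge0 => v _; rewrite mule_ge0// lee_fin expR_ge0.
transitivity (\int[normal_prob 0 1]_x F (t + x)%R).
  apply: eq_integral => x _.
  rewrite /F -(IHn s (fun v => f (row_cons ((t + x)%R, v))))//; last first.
    exact: measurable_row_cons_snd.
  by apply: eq_integral => v _; rewrite row_consD.
have mF : measurable_fun setT F.
  (* A zero first coordinate makes the exponent depend on [v] alone, which exhibits [F] as a partial
     integral of a single function of [n.+1] coordinates. *)
  pose ss : 'rV[R]_n.+1 := row_cons (0%R, s).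
  pose h g := f g * (expR (dot ss g - dot ss ss / 2))%:E.
  rewrite (_ : F = fun x => \int[std_gauss n]_v h (row_cons (x, v))); last first.
    apply/funext => x; apply: eq_integral => v _.
    by rewrite /h !dot_row_cons !mul0r !add0r.
  apply: (@measurable_integral_row_cons _ h).
    by apply: emeasurable_funM => //; exact: mexp.
  by move=> x; rewrite mule_ge0// lee_fin expR_ge0.
rewrite normal_prob_shift//.
apply: eq_integral => x _.
rewrite -ge0_integralZr ?lee_fin ?expR_ge0//; last 2 first.
- apply: emeasurable_funM; first exact: measurable_row_cons_snd.
  exact: mexp.
- by move=> v _; rewrite mule_ge0// lee_fin expR_ge0.
apply: eq_integral => v _; rewrite -muleA -EFinM -expRD !dot_row_cons.
by congr (_ * (expR _)%:E); field.
Qed.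

(** The quadratic cost is a sum over coordinates. For fixed first coordinates [x] and [y], the
    induction hypothesis handles the remaining ones and shows that the inner integrals satisfy the
    one-dimensional hypothesis. *)
Lemma std_gauss_infconv d (A B : 'rV[R]_d -> \bar R) :
  measurable_fun setT A -> measurable_fun setT B ->
  (forall x, 0 <= A x) -> (forall x, 0 <= B x) ->
  (forall x y, A x * B y <= (expR (dot (x - y) (x - y) / 4))%:E) ->
  \int[std_gauss d]_x A x * \int[std_gauss d]_x B x <= 1.
Proof.
elim: d A B => [|n IHn] A B mA mB A0 B0 AB.
  rewrite /= !integral_dirac// diracT !mul1e.
  by rewrite (le_trans (AB _ _))// subrr dot0l mul0r expR0.
rewrite !integral_std_gaussS//; apply: normal_prob_infconv.
- exact: measurable_integral_row_cons.
- exact: measurable_integral_row_cons.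
- by move=> x; exact: integral_ge0.
- by move=> x; exact: integral_ge0.
move=> x y; set c := expR _.
have c0 : (0 < c)%R by exact: expR_gt0.
have ci0 : 0 <= (c^-1)%:E by rewrite lee_fin invr_ge0 ltW.
(* The factor [c^-1] pays for the first coordinate's share of the cost, leaving only the distance
   between the remaining coordinates. *)
have := IHn (fun v => A (row_cons (x, v))) (fun v => (c^-1)%:E * B (row_cons (y, v))).
rewrite ge0_integralZl//; last exact: measurable_row_cons_snd.
rewrite muleCA => h.
rewrite -[leLHS]mul1e -[X in X * _](_ : c%:E * (c^-1)%:E = 1); last first.
  by rewrite -EFinM mulfV// gt_eqF.
rewrite -muleA -[leRHS]mule1 lee_wpmul2l ?lee_fin ?(ltW c0)//; apply: h.
- exact: measurable_row_cons_snd.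
- by apply: emeasurable_funM => //; exact: measurable_row_cons_snd.
- by [].
- by move=> v; rewrite mule_ge0.
move=> u v; rewrite muleCA.
apply: (le_trans (lee_wpmul2l ci0 (AB _ _))).
rewrite row_consB dot_row_cons -EFinM lee_fin mulrDl expRD -expr2.
by rewrite mulrA mulVf ?mul1r// gt_eqF.
Qed.

End std_gauss_theory.

(** * Projection onto a closed convex cone *)

Section euclidean.
Context {R : realType} {d : nat}.
Implicit Types (u v w x y : 'rV[R]_d) (K C : set 'rV[R]_d).

Lemma continuous_idfun (T : topologicalType) : continuous (@id T).
Proof. by move=> t; exact: cvg_id. Qed.

Lemma continuous_big_sum (T : topologicalType) (I : Type) (s : seq I)
    (f : I -> T -> R) : (forall i, continuous (f i)) ->
  continuous (fun t => \sum_(i <- s) f i t).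
Proof.
move=> cf t; elim: s => [|i s IHs].
  by under eq_fun do rewrite big_nil; exact: cvg_cst.
under eq_fun do rewrite big_cons.
by apply: cvgD => //; exact: cf.
Qed.

Lemma continuous_dot (T : topologicalType) (f g : T -> 'rV[R]_d) :
  continuous f -> continuous g -> continuous (fun t => dot (f t) (g t)).
Proof.
move=> cf cg; under eq_fun do rewrite dotE.
apply: continuous_big_sum => i t; apply: cvgM.
  exact: (@continuous_comp _ _ _ f (fun A : 'rV[R]_d => A ord0 i) t (cf t)
    (@coord_continuous _ _ _ _ _ _)).
exact: (@continuous_comp _ _ _ g (fun A : 'rV[R]_d => A ord0 i) t (cg t)
  (@coord_continuous _ _ _ _ _ _)).
Qed.

Lemma sqr_enorm x : enorm x ^+ 2 = dot x x.
Proof. by rewrite sqr_sqrtr ?dot_ge0. Qed.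

Lemma enorm_ge0 x : 0 <= enorm x.
Proof. exact: sqrtr_ge0. Qed.

Lemma enorm_eq0 x : (enorm x == 0) = (x == 0).
Proof. by rewrite sqrtr_eq0 le_eqVlt ltNge dot_ge0 orbF dot_eq0. Qed.

Lemma enorm0 : enorm (0 : 'rV[R]_d) = 0.
Proof. by apply/eqP; rewrite enorm_eq0. Qed.

Lemma enormZ a x : enorm (a *: x) = `|a| * enorm x.
Proof. by rewrite /enorm dotZl dotZr mulrA -expr2 sqrtrM ?sqr_ge0// sqrtr_sqr. Qed.

Lemma enormN x : enorm (- x) = enorm x.
Proof. by rewrite /enorm dotNl dotNr opprK. Qed.

Lemma enormB x y : enorm (x - y) = enorm (y - x).
Proof. by rewrite -enormN opprB. Qed.

Lemma cauchy_schwarz u v : dot u v <= enorm u * enorm v.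
Proof.
have [/eqP|u0] := eqVneq (enorm u) 0.
  by rewrite enorm_eq0 => /eqP ->; rewrite dot0l enorm0 mul0r.
have [/eqP|v0] := eqVneq (enorm v) 0.
  by rewrite enorm_eq0 => /eqP ->; rewrite dot0r enorm0 mulr0.
have up : 0 < enorm u by rewrite lt_def u0 enorm_ge0.
have vp : 0 < enorm v by rewrite lt_def v0 enorm_ge0.
have := dot_ge0 (enorm v *: u - enorm u *: v).
rewrite dotBl !dotBr !dotZl !dotZr (dotC v u) -!sqr_enorm => h.
by rewrite -(ler_pM2l (mulr_gt0 up vp)); lra.
Qed.

Lemma ler_enormD u v : enorm (u + v) <= enorm u + enorm v.
Proof.
rewrite -(@ler_pXn2r _ 2)// ?nnegrE ?addr_ge0 ?enorm_ge0//.
rewrite sqr_enorm dotDl !dotDr (dotC v u) -!sqr_enorm.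
by have := cauchy_schwarz u v; lra.
Qed.

Lemma ler_dist_enorm u v : `|enorm u - enorm v| <= enorm (u - v).
Proof.
have := ler_enormD (u - v) v; have := ler_enormD (v - u) u.
rewrite !subrK (enormB v u) => h1 h2.
by rewrite ler_norml; apply/andP; split; lra.
Qed.

Lemma ler_coord_enorm u i : `|u ord0 i| <= enorm u.
Proof.
rewrite -[leLHS]sqrtr_sqr ler_sqrt ?dot_ge0// dotE (bigD1 i)//= expr2 lerDl.
by apply: sumr_ge0 => j _; rewrite -expr2 sqr_ge0.
Qed.

Lemma continuous_enorm (T : topologicalType) (f : T -> 'rV[R]_d) :
  continuous f -> continuous (fun t => enorm (f t)).
Proof.
move=> cf t; apply: (@continuous_comp _ _ _ (fun t => dot (f t) (f t)) Num.sqrt).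
  exact: continuous_dot.
exact: sqrt_continuous.
Qed.

Lemma continuous_enormB (T : topologicalType) x (f : T -> 'rV[R]_d) :
  continuous f -> continuous (fun t => enorm (x - f t)).
Proof.
move=> cf; apply: continuous_enorm => t; apply: cvgB; last exact: cf.
exact: cvg_cst.
Qed.

(** Passes from Euclidean Lipschitz bounds to the sup-norm topology of matrices: the modulus
    [enorm (x - y)] is itself continuous in that topology, so the two norms need not be compared
    quantitatively. *)
Lemma continuous_dominated (T : topologicalType) (f : T -> R)
    (g : T -> T -> R) : (forall t, g t t = 0) -> (forall t, continuous (g t)) ->
  (forall t t', `|f t - f t'| <= g t t') -> continuous f.
Proof.
move=> g0 cg fg t; apply/cvgrPdist_le => e e0.
have : g t @ t --> g t t by exact: cg.
rewrite g0 => /cvgrPdist_le/(_ e e0); apply: filterS => t'.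
rewrite sub0r normrN => h; apply: (le_trans (fg t t')).
by apply: le_trans h; exact: ler_norm.
Qed.

Lemma lipschitz_continuous (f : 'rV[R]_d -> R) :
  (forall x y, `|f x - f y| <= enorm (x - y)) -> continuous f.
Proof.
move=> lf; apply: (@continuous_dominated _ _ (fun x y => enorm (x - y))) => // x.
  by rewrite subrr enorm0.
exact: (@continuous_enormB _ x id (@continuous_idfun _)).
Qed.

(** Convexity appears as stability under addition, which for cones is equivalent and gives the
    competitors [p + s v] directly. *)
Definition pointed_cone K : Prop :=
  [/\ closed K, K 0, (forall u v, K u -> K v -> K (u + v)) &
      forall (a : R) u, 0 <= a -> K u -> K (a *: u)].

Lemma closed_convex_cone_pointed C : closed_convex_cone C -> pointed_cone C.
Proof.
move=> [[x Cx] clC cvC scC].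
split=> //; first by rewrite -(scale0r x); exact: scC.
move=> u v Cu Cv.
have h0 : 0 <= 2^-1 :> R by rewrite invr_ge0.
have h1 : 2^-1 <= 1 :> R by lra.
have : ((2^-1 : R) *: u + (1 - 2^-1 : R) *: v) \in C.
  exact: (cvC u v (Itv01 h0 h1) (mem_set Cu) (mem_set Cv)).
rewrite inE => /(scC 2 _ (ler0n _ _)).
by rewrite (_ : 1 - 2^-1 = 2^-1 :> R) -?scalerDr ?scalerA ?mulfV ?scale1r//; lra.
Qed.

Lemma pointed_cone_polarI C1 C2 : pointed_cone C2 ->
  pointed_cone (C2 `&` polar C1).
Proof.
move=> [clC C0 CD CZ]; split.
- apply: closedI => //.
  rewrite (_ : polar C1 = \bigcap_(u in C1) [set v | dot v u <= 0]); last first.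
    by apply/seteqP; split.
  apply: closed_bigI => u _.
  apply: (@preimage_closed _ _ (fun v => dot v u) [set x | x <= 0]).
    move=> v _.
    exact: (@continuous_dot _ id _ (@continuous_idfun _) (@cst_continuous _ _ u)).
  exact: closed_le.
- by split => // u _; rewrite dot0l.
- move=> u v [Cu Pu] [Cv Pv]; split; first exact: CD.
  by move=> w Cw; rewrite dotDl -[leRHS]addr0 lerD ?Pu ?Pv.
- move=> a u a0 [Cu Pu]; split; first exact: CZ.
  by move=> w Cw; rewrite dotZl mulr_ge0_le0 ?Pu.
Qed.

Section projection.
Variable K : set 'rV[R]_d.
Hypothesis coneK : pointed_cone K.

Lemma proj_min x :
  K (proj K x) /\ forall v, K v -> enorm (x - proj K x) <= enorm (x - v).
Proof.
have [clK K0 _ _] := coneK.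
apply: (@getPex _ [set u | K u /\ forall v, K v -> enorm (x - u) <= enorm (x - v)]).
have ce : continuous (fun u => enorm (x - u)).
  exact: (@continuous_enormB _ x id (@continuous_idfun _)).
(* Only points at least as close to [x] as the apex [0] can be minimizers, and these form a compact
   set. *)
pose A := K `&` [set u | enorm (x - u) <= enorm (x - 0)].
have cA : compact A.
  apply: bounded_closed_compact; last first.
    apply: closedI => //.
    apply: (@preimage_closed _ _ _ [set z | z <= enorm (x - 0)]) => //.
  exists (enorm x + enorm x); split; first exact: num_real.
  move=> M xM u [_ /= xu]; rewrite [leLHS]/Num.norm/= mx_normrE.
  apply/bigmax_leP; split => [|[i j] _ /=].
    by rewrite (le_trans _ (ltW xM))// addr_ge0 ?enorm_ge0.
  rewrite ord1 (le_trans (ler_coord_enorm _ _))// (le_trans _ (ltW xM))//.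
  rewrite subr0 in xu.
  have -> : u = x - (x - u) by rewrite opprB addrC subrK.
  by rewrite (le_trans (ler_enormD _ _))// enormN lerD2l.
have A0 : A !=set0 by exists 0; split => //=.
have [u /set_mem [Ku xu] umin] := EVT_min_rV A0 cA (continuous_subspaceT ce).
exists u; split => // v Kv.
have [xv|/ltW xv] := leP (enorm (x - v)) (enorm (x - 0)).
  by apply: umin; rewrite inE.
by rewrite (le_trans xu).
Qed.

Lemma proj_in x : K (proj K x).
Proof. by have [] := proj_min x. Qed.

Lemma dot_proj_le x v : K v -> dot (x - proj K x) v <= 0.
Proof.
move=> Kv; have [Kp pmin] := proj_min x; have [_ _ KD KZ] := coneK.
set p := proj K x in Kp pmin *.
rewrite leNgt; apply/negP => c0.
have v0 : 0 < dot v v.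
  rewrite lt_def dot_ge0 dot_eq0 andbT; apply/eqP => v0.
  by move: c0; rewrite v0 dot0r ltxx.
(* The step along [v] that minimizes the distance to [x]; a positive one would strictly improve on
   [p]. *)
pose s := dot (x - p) v / dot v v.
have s0 : 0 < s by rewrite divr_gt0.
have := pmin _ (KD _ _ Kp (KZ _ _ (ltW s0) Kv)).
rewrite -(@ler_pXn2r _ 2)// ?nnegrE ?enorm_ge0// !sqr_enorm opprD addrA.
move: (x - p) c0 @s s0 => r c0 s s0.
rewrite [leRHS]dotBl !dotBr !dotZl !dotZr (dotC v r) => h.
have e : s * dot v v = dot r v by rewrite divfK// gt_eqF.
have : 0 < s * dot r v by rewrite mulr_gt0.
by move: h; rewrite e; lra.
Qed.

(** Orthogonality in Moreau's decomposition. One sign is [dot_proj_le] at [proj K x] itself; for the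
    other, shrinking the projection towards [0] would bring it closer to [x]. *)
Lemma dot_proj x : dot (x - proj K x) (proj K x) = 0.
Proof.
have [Kp pmin] := proj_min x; have [_ _ KD KZ] := coneK.
apply/eqP; rewrite eq_le dot_proj_le//=.
set p := proj K x in Kp pmin *.
rewrite leNgt; apply/negP => c0.
have p0 : 0 < dot p p.
  rewrite lt_def dot_ge0 dot_eq0 andbT; apply/eqP => p0.
  by move: c0; rewrite p0 dot0r ltxx.
(* The cap at 1 keeps the competitor [(1 - s) *: p] in the cone. *)
pose s := Num.min 1 (- dot (x - p) p / dot p p).
have s0 : 0 < s by rewrite lt_min ltr01 divr_gt0// oppr_gt0.
have s1 : s <= 1 by rewrite ge_min lexx.
have s2 : s * dot p p <= - dot (x - p) p.
  by rewrite -ler_pdivlMr// ge_min lexx orbT.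
have := pmin ((1 - s) *: p); rewrite -(@ler_pXn2r _ 2)// ?nnegrE ?enorm_ge0//.
have -> : x - (1 - s) *: p = (x - p) + s *: p.
  by rewrite scalerBl scale1r opprB addrCA addrC.
rewrite !sqr_enorm => h.
have {}h := h (KZ _ _ _ Kp); rewrite subr_ge0 in h; have {}h := h s1.
move: (x - p) c0 @s s0 s1 s2 h => r c0 s s0 s1 s2 h.
rewrite [leRHS]dotDl !dotDr !dotZl !dotZr (dotC p r) in h.
have : s * (s * dot p p) <= s * (- dot r p) by rewrite ler_pM2l.
have : 0 < s * - dot r p by rewrite mulr_gt0 ?oppr_gt0.
by move: h; lra.
Qed.

(** The two variational inequalities and the two orthogonality relations give |p - q|^2 <= <x - y, p
    - q>; Cauchy-Schwarz concludes. *)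
Lemma enorm_proj_lip x y : enorm (proj K x - proj K y) <= enorm (x - y).
Proof.
have := dot_proj_le x (proj_in y); have := dot_proj_le y (proj_in x).
have := dot_proj x; have := dot_proj y.
move: (proj K x) (proj K y) => p q ey ex hy hx.
have h : enorm (p - q) ^+ 2 <= enorm (x - y) * enorm (p - q).
  apply: le_trans (cauchy_schwarz _ _); rewrite sqr_enorm.
  move: hx hy ex ey; rewrite !dotBl !dotBr (dotC q p); lra.
have [->|pq0] := eqVneq (enorm (p - q)) 0; first exact: enorm_ge0.
by rewrite -(@ler_pM2r _ (enorm (p - q))) ?lt_def ?pq0 ?enorm_ge0// -expr2.
Qed.

Lemma dot_proj_lip v x y :
  `|dot (proj K x) v - dot (proj K y) v| <= enorm (x - y) * enorm v.
Proof.
have h : enorm (proj K x - proj K y) * enorm v <= enorm (x - y) * enorm v.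
  by rewrite ler_wpM2r ?enorm_ge0 ?enorm_proj_lip.
rewrite -dotBl ler_norml; apply/andP; split; last first.
  exact: le_trans (cauchy_schwarz _ _) h.
by rewrite lerNl -dotNl (le_trans (cauchy_schwarz _ _))// enormN.
Qed.

Lemma enorm_proj_sub x y :
  `|enorm (proj K x) - enorm (proj K y)| <= enorm (x - y).
Proof.
exact: le_trans (ler_dist_enorm _ _) (enorm_proj_lip x y).
Qed.

Lemma continuous_proj_coord i : continuous (fun x => proj K x ord0 i).
Proof.
apply: lipschitz_continuous => x y.
apply: le_trans (enorm_proj_lip x y).
by apply: le_trans (ler_coord_enorm _ i); rewrite !mxE.
Qed.

End projection.

(** The apex is a nearest point: [dot u v <= 0] for [v] in [C] makes |u - v|^2 at least |u|^2. *)
Lemma dist_to_polar C u : C 0 -> polar C u -> dist_to C u = enorm u.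
Proof.
move=> C0 Pu; apply/eqP; rewrite eq_le; apply/andP; split.
  apply: ge_inf; last by exists 0; rewrite ?subr0.
  by exists 0 => _ [v _ <-]; exact: enorm_ge0.
apply: lb_le_inf; first by exists (enorm (u - 0)), 0.
move=> _ [v Cv <-]; rewrite ler_sqrt ?dot_ge0// dotBl !dotBr (dotC v u).
by have := Pu _ Cv; have := dot_ge0 v; lra.
Qed.

End euclidean.

(** * Measurability of continuous functions for the sigma-algebra generated by the coordinates *)

Section continuous_measurable.
Context {R : realType} {d : nat}.

(* Rounding to the grid (Z/(n+1))^d is measurable with countable range, and
   converges pointwise to the identity. *)
Lemma measurable_continuous_rV (f : 'rV[R]_d -> R) :
  continuous f -> measurable_fun setT f.
Proof.
move=> cf.
pose z n (x : 'rV[R]_d) : 'rV[int]_d := \row_i Num.floor (x ord0 i * n.+1%:R).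
pose g n (k : 'rV[int]_d) : 'rV[R]_d := \row_i ((k ord0 i)%:~R / n.+1%:R).
apply: (@measurable_fun_cvg _ _ _ _ (fun n x => f (g n (z n x)))).
  move=> n _ Y mY; rewrite setTI.
  rewrite (_ : _ @^-1` _ = \bigcup_(k : 'rV[int]_d)
     ([set x | z n x = k] `&` [set x | Y (f (g n k))])); last first.
    by apply/seteqP; split=> [x Yx|x [k _ [/= <-]]]//; exists (z n x).
  apply: countable_bigcupT_measurable; first exact: countableP.
  move=> k; apply: measurableI; last first.
    have [Yk|Yk] := pselect (Y (f (g n k))).
      by rewrite (_ : [set _ | _] = setT)//; apply/seteqP; split.
    by rewrite (_ : [set _ | _] = set0)//; apply/seteqP; split.
  rewrite (_ : [set _ | _] = \bigcap_(i in [set: 'I_d])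
    (fun x : 'rV[R]_d => x ord0 i) @^-1`
      `[(k ord0 i)%:~R / n.+1%:R, (k ord0 i + 1)%:~R / n.+1%:R[); last first.
    apply/seteqP; split=> [x /= <- i _|x /= h].
      rewrite /= in_itv/= !mxE ler_pdivrMr// ltr_pdivlMr//.
      exact: floor_itv.
    apply/rowP => i; rewrite mxE; have := h i I.
    rewrite /= in_itv/= ler_pdivrMr// ltr_pdivlMr// => hi.
    exact: floor_def.
  apply: fin_bigcap_measurable => // i _.
  rewrite -[X in measurable X]setTI; apply: measurable_coord => //.
move=> x _; apply: (@continuous_cvg _ _ _ _ _ (fun n => g n (z n x)) f).
  exact: cf.
apply/cvgrPdist_lt => e e0; near=> n.
have n0 : (0 : R) < n.+1%:R by [].
rewrite [X in X < _]/Num.norm/= mx_normrE.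
apply/bigmax_ltP; split => // -[i j] _ /=; rewrite !mxE ord1.
have /andP[h1 h2] := floor_itv (x ord0 j * n.+1%:R).
set y := Num.floor _ in h1 h2 *.
have : n.+1%:R^-1 < e.
  near: n; exact: near_infty_natSinv_lt (PosNum e0).
apply: le_lt_trans; rewrite ler_norml.
rewrite intrD in h2.
move: (y%:~R) (x ord0 j) (n.+1%:R) n0 h1 h2 => p q m m0 h1 h2.
by apply/andP; split; rewrite -(ler_pM2r m0) ?mulNr mulVf ?gt_eqF// mulrBl
  divfK ?gt_eqF//; lra.
Unshelve. all: by end_near.
Qed.

End continuous_measurable.

(** * Second moment method *)

Section chi_square.
Context {R : realType} {d : nat}.
Local Open Scope ereal_scope.
Notation gamma := (@std_gauss R d).
Implicit Types (th : 'rV[R]_d -> 'rV[R]_d) (D : set 'rV[R]_d).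

(** The density of N(t, I) with respect to N(0, I). *)
Definition likelihood (t g : 'rV[R]_d) : R := expR (dot t g - dot t t / 2).

Lemma likelihood_ge0 t g : (0 <= likelihood t g)%R.
Proof. exact: expR_ge0. Qed.

Lemma measurable_likelihood dU (U : measurableType dU) (f g : U -> 'rV[R]_d) :
  measurable_fun setT f -> measurable_fun setT g ->
  measurable_fun setT (fun x => likelihood (f x) (g x)).
Proof.
move=> mf mg; apply: measurableT_comp => //; apply: measurable_funB.
  exact: measurable_dot.
by apply: measurable_funM => //; exact: measurable_dot.
Qed.

Lemma std_gauss_likelihood (t : 'rV[R]_d) (f : 'rV[R]_d -> R) :
  measurable_fun setT f -> (forall x, (0 <= f x)%R) ->
  \int[gamma]_g (f (t + g)%R)%:E = \int[gamma]_g (f g * likelihood t g)%:E.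
Proof.
move=> mf f0; rewrite (std_gauss_shift t (f := EFin \o f))//.
by apply/measurable_EFinP.
Qed.

Lemma integral_likelihood (t : 'rV[R]_d) : \int[gamma]_g (likelihood t g)%:E = 1.
Proof.
have := @std_gauss_likelihood t (cst 1%R).
under [X in _ -> _ -> _ = X]eq_integral do rewrite /cst mul1r.
by rewrite /cst integral_cst//= probability_setT mule1 => <-.
Qed.

(** The product of two likelihoods is [expR (dot s t)] times the likelihood of [s + t], which has
    mean 1. Second moments of mixtures thereby become exponential moments of inner products. *)
Lemma integral_likelihoodM (s t : 'rV[R]_d) :
  \int[gamma]_g (likelihood s g * likelihood t g)%:E = (expR (dot s t))%:E.
Proof.
have E g : (likelihood s g * likelihood t g =
    expR (dot s t) * likelihood (s + t) g)%R.
  rewrite /likelihood -!expRD; congr expR.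
  by rewrite !dotDl !dotDr (dotC t s); field.
under eq_integral do rewrite E EFinM.
rewrite ge0_integralZl ?lee_fin ?expR_ge0 ?integral_likelihood ?mule1//.
- apply/measurable_EFinP; apply: measurable_likelihood; first exact: measurable_cst.
  exact: measurable_id.
- by move=> g _; rewrite lee_fin likelihood_ge0.
Qed.

(** The prior is the law of [sigma *: th x] for Gaussian [x] restricted to [D], left unnormalised:
    its likelihood ratio [L] has mean [p], hence the threshold [2 * p ^+ 2] for a normalised second
    moment of at most 2. Averaging bounds [p] by [p * S1 + p * S2 + p / 2], where [S1] and [S2] are
    the two suprema in the error. *)
Lemma chi_square_bound (sigma eps p : R) (C1 C2 D : set 'rV[R]_d)
    (th : 'rV[R]_d -> 'rV[R]_d) (psi : 'rV[R]_d -> bool) :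
  C1 0%R -> measurable D -> gamma D = p%:E -> (0 < p)%R ->
  measurable_fun setT th ->
  (forall x, D x -> (C2 `\` tube C1 eps) (sigma *: th x)) ->
  \int[gamma]_x \int[gamma]_y
    (\1_D x * \1_D y * expR (dot (th x) (th y)))%:E <= (2 * p ^+ 2)%:E ->
  measurable_fun setT psi ->
  (1 / 2)%:E <= uniform_error sigma psi C1 C2 eps.
Proof.
move=> C10 mD gD p0 mth thD chi mpsi.
have msc : measurable_fun setT (fun g : 'rV[R]_d => (sigma *: g)%R).
  by apply: measurable_rV_scale; exact: measurable_id.
(* The test in units of the noise: at [sigma *: t] the observation is [sigma *: (t + g)], so [sigma]
   leaves the likelihoods. *)
pose Phi (g : 'rV[R]_d) : R := (psi (sigma *: g))%:R%R.
have Phi01 g : (0 <= Phi g <= 1)%R.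
  by rewrite /Phi; case: (psi _); rewrite /= ?lexx ler01.
have Phi0 g : (0 <= Phi g)%R by have /andP[] := Phi01 g.
have Phi1 g : (0 <= 1 - Phi g)%R by rewrite subr_ge0; have /andP[] := Phi01 g.
have mPhi : measurable_fun setT Phi.
  have mb : measurable_fun setT (fun b : bool => b%:R%R : R) by [].
  exact: (measurableT_comp mb (measurableT_comp mpsi msc)).
have mPhi1 : measurable_fun setT (fun g => 1 - Phi g)%R by exact: measurable_funB.
pose w (x : 'rV[R]_d) : R := \1_D x.
have mw : measurable_fun setT w by exact: measurable_indic.
have w0 x : (0 <= w x)%R by rewrite /w indicE.
have intw : \int[gamma]_x (w x)%:E = p%:E.
  by rewrite /w integral_indic// setIT -gD.
have k0 := likelihood_ge0.
pose a (x g : 'rV[R]_d) : R := (w x * likelihood (th x) g)%R.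
have a0 x g : (0 <= a x g)%R by rewrite mulr_ge0.
have ma2 : measurable_fun setT (fun z : 'rV[R]_d * 'rV[R]_d => a z.1 z.2).
  apply: measurable_funM; first exact: (measurableT_comp mw).
  apply: measurable_likelihood; last exact: measurable_snd.
  exact: (measurableT_comp mth).
have ma2' : measurable_fun setT (fun z : 'rV[R]_d * 'rV[R]_d => a z.2 z.1).
  apply: measurable_funM; first exact: (measurableT_comp mw).
  apply: measurable_likelihood; last exact: measurable_fst.
  exact: (measurableT_comp mth).
have max g : measurable_fun setT (a ^~ g).
  exact: (measurableT_comp ma2 (pair2_measurable g)).
have mag x : measurable_fun setT (a x).
  exact: (measurableT_comp ma2 (pair1_measurable x)).
pose L g := \int[gamma]_x (a x g)%:E.
have L0 g : 0 <= L g by apply: integral_ge0 => x _; rewrite lee_fin.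
have mL : measurable_fun setT L.
  apply: (measurable_fun_fubini_tonelli_G (m1 := gamma)
    (fun z => (a z.1 z.2)%:E)) => //.
    exact/measurable_EFinP.
  by move=> z; rewrite lee_fin.
have intL : \int[gamma]_g L g = p%:E.
  rewrite -(fubini_tonelli (m1 := gamma) (m2 := gamma)
    (fun z => (a z.1 z.2)%:E))/=; last 2 first.
  - exact/measurable_EFinP.
  - by move=> z; rewrite lee_fin.
  rewrite -intw; apply: eq_integral => x _.
  under eq_integral do rewrite EFinM.
  rewrite ge0_integralZl ?lee_fin// ?integral_likelihood ?mule1//.
    apply/measurable_EFinP; apply: measurable_likelihood; first exact: measurable_cst.
    exact: measurable_id.
  by move=> g _; rewrite lee_fin.
have intLL : \int[gamma]_g (L g * L g) <= (2 * p ^+ 2)%:E.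
  apply: le_trans chi; rewrite le_eqVlt; apply/orP; left; apply/eqP.
  transitivity (\int[gamma]_g \int[gamma]_x ((a x g)%:E * L g)).
    apply: eq_integral => g _; rewrite ge0_integralZr//.
    - exact/measurable_EFinP.
    - by move=> x _; rewrite lee_fin.
  rewrite -(fubini_tonelli (m1 := gamma) (m2 := gamma)
    (fun z => (a z.1 z.2)%:E * L z.2))/=; last 2 first.
  - apply: emeasurable_funM; first exact/measurable_EFinP.
    exact: (measurableT_comp mL).
  - by move=> z; rewrite mule_ge0// lee_fin.
  apply: eq_integral => x _.
  transitivity (\int[gamma]_g \int[gamma]_y (a x g * a y g)%:E).
    apply: eq_integral => g _; under [RHS]eq_integral do rewrite EFinM.
    rewrite ge0_integralZl ?lee_fin//.
    - exact/measurable_EFinP.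
    - by move=> y _; rewrite lee_fin.
  rewrite (fubini_tonelli (m1 := gamma) (m2 := gamma)
    (fun z => (a x z.1 * a z.2 z.1)%:E))/=; last 2 first.
  - apply/measurable_EFinP; apply: measurable_funM; last exact: ma2'.
    exact: (measurableT_comp (mag x)).
  - by move=> z; rewrite lee_fin mulr_ge0.
  apply: eq_integral => y _.
  transitivity (\int[gamma]_g ((w x * w y)%:E *
      (likelihood (th x) g * likelihood (th y) g)%:E)).
    by apply: eq_integral => g _; rewrite -EFinM /a mulrACA.
  rewrite ge0_integralZl ?lee_fin ?mulr_ge0// ?integral_likelihoodM//.
    by apply/measurable_EFinP; apply: measurable_funM;
      apply: measurable_likelihood; (exact: measurable_cst || exact: measurable_id).
  by move=> g _; rewrite lee_fin mulr_ge0.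
(* AM-GM: L <= p + L^2 / (4 p) where the test rejects. *)
have pw g : L g <= (p * Phi g)%:E + (1 - Phi g)%:E * L g +
    ((4 * p)^-1)%:E * (L g * L g).
  have cp : (0 < (4 * p)^-1)%R by rewrite invr_gt0 mulr_gt0.
  rewrite /Phi; case: (psi _) => /=.
    rewrite subrr mul0e adde0 mulr1.
    have := L0 g; case: (L g) => [l| |]// l0.
      rewrite -!EFinM -EFinD lee_fin.
      have : (0 <= (4 * p)^-1 * (l - 2 * p) ^+ 2)%R by rewrite mulr_ge0 ?sqr_ge0// ltW.
      rewrite [X in (0 <= X)%R](_ : _ = (4 * p)^-1 * (l * l) - l + p)%R.
        by lra.
      by field; rewrite gt_eqF.
    by rewrite mulyy gt0_muley ?lte_fin// addey.
  rewrite subr0 mul1e mulr0 add0e leeDl//.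
  by rewrite mule_ge0 ?mule_ge0// lee_fin ltW.
have S1E : mean_at sigma 0 (fun y => (psi y)%:R%R) = \int[gamma]_g (Phi g)%:E.
  by rewrite /mean_at unlock; under eq_integral do rewrite add0r.
have S2E x : mean_at sigma (sigma *: th x) (fun y => 1 - (psi y)%:R)%R =
    \int[gamma]_g ((1 - Phi g) * likelihood (th x) g)%:E.
  rewrite /mean_at unlock -std_gauss_likelihood//.
  by apply: eq_integral => g _; rewrite -scalerDr.
rewrite /uniform_error; set S1 := ereal_sup _; set S2 := ereal_sup _.
have S1ge : \int[gamma]_g (Phi g)%:E <= S1.
  by rewrite -S1E; apply: ereal_sup_ubound; exists 0%R.
have S2ge x : D x -> \int[gamma]_g ((1 - Phi g) * likelihood (th x) g)%:E <= S2.
  move=> Dx; rewrite -S2E; apply: ereal_sup_ubound.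
  by exists (sigma *: th x)%R => //; exact: thD.
have S10 : 0 <= S1 by apply: le_trans S1ge; apply: integral_ge0 => g _; rewrite lee_fin.
have S20 : 0 <= S2.
  have [x Dx] : D !=set0.
    apply/set0P/negP => /eqP D0; move: gD; rewrite D0 measure0 => -[p00].
    by move: p0; rewrite -p00 ltxx.
  apply: le_trans (S2ge x Dx); apply: integral_ge0 => g _.
  by rewrite lee_fin mulr_ge0.
(* The error under the mixture is an average of errors at alternatives; the weight [w] vanishes off
   [D], where no bound by [S2] is available. *)
have pS2 : \int[gamma]_g ((1 - Phi g)%:E * L g) <= p%:E * S2.
  have -> : \int[gamma]_g ((1 - Phi g)%:E * L g) =
      \int[gamma]_x \int[gamma]_g ((1 - Phi g) * a x g)%:E.
    rewrite (fubini_tonelli (m1 := gamma) (m2 := gamma)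
      (fun z => ((1 - Phi z.2) * a z.1 z.2)%:E))/=; last 2 first.
    - apply/measurable_EFinP; apply: measurable_funM => //.
      exact: (measurableT_comp mPhi1).
    - by move=> z; rewrite lee_fin mulr_ge0.
    apply: eq_integral => g _; under [RHS]eq_integral do rewrite EFinM.
    rewrite ge0_integralZl ?lee_fin//.
    - exact/measurable_EFinP.
    - by move=> x _; rewrite lee_fin.
  have -> : p%:E * S2 = \int[gamma]_x ((w x)%:E * S2).
    rewrite ge0_integralZr ?intw//.
    - exact/measurable_EFinP.
    - by move=> x _; rewrite lee_fin.
  apply: ge0_le_integral => //.
  - by move=> x _; apply: integral_ge0 => g _; rewrite lee_fin mulr_ge0.
  - apply: (measurable_fun_fubini_tonelli_F (m2 := gamma)
      (fun z => ((1 - Phi z.2) * a z.1 z.2)%:E)).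
      apply/measurable_EFinP; apply: measurable_funM => //.
      exact: (measurableT_comp mPhi1).
    by move=> z; rewrite lee_fin mulr_ge0.
  - by apply: emeasurable_funM => //; exact/measurable_EFinP.
  move=> x _; rewrite /a /w indicE; case: (boolP (x \in D)) => xD.
    rewrite mul1e; under eq_integral do rewrite mul1r.
    by apply: S2ge; exact/set_mem.
  rewrite mul0e integral0_eq// => g _; by rewrite mul0r mulr0.
have : p%:E <= p%:E * S1 + p%:E * S2 + (p / 2)%:E.
  rewrite -[leLHS]intL.
  have mLL : measurable_fun setT (fun g => ((4 * p)^-1)%:E * (L g * L g)).
    by apply: emeasurable_funM => //; exact: emeasurable_funM.
  have mpPhi : measurable_fun setT (fun g => (p * Phi g)%:E).
    by apply/measurable_EFinP; exact: measurable_funM.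
  have m1L : measurable_fun setT (fun g => (1 - Phi g)%:E * L g).
    by apply: emeasurable_funM => //; exact/measurable_EFinP.
  have q0 : 0 <= ((4 * p)^-1)%:E by rewrite lee_fin invr_ge0 mulr_ge0// ltW.
  apply: (@le_trans _ _ (\int[gamma]_g ((p * Phi g)%:E + (1 - Phi g)%:E * L g +
      ((4 * p)^-1)%:E * (L g * L g)))).
    apply: ge0_le_integral => //.
    apply: emeasurable_funD => //; exact: emeasurable_funD.
  rewrite ge0_integralD//; last 3 first.
  - by move=> g _; rewrite adde_ge0 ?mule_ge0 ?lee_fin ?mulr_ge0// ltW.
  - exact: emeasurable_funD.
  - by move=> g _; rewrite mule_ge0 ?mule_ge0.
  rewrite ge0_integralD//; last 2 first.
  - by move=> g _; rewrite lee_fin mulr_ge0// ltW.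
  - by move=> g _; rewrite mule_ge0 ?lee_fin.
  apply: leeD.
    apply: leeD => //.
    under eq_integral do rewrite EFinM.
    rewrite ge0_integralZl//; last 3 first.
    - exact/measurable_EFinP.
    - by move=> g _; rewrite lee_fin.
    - by rewrite lee_fin ltW.
    by rewrite lee_wpmul2l// lee_fin ltW.
  rewrite ge0_integralZl//; last 2 first.
  - exact: emeasurable_funM.
  - by move=> g _; rewrite mule_ge0.
  apply: (le_trans (lee_wpmul2l q0 intLL)).
  rewrite -EFinM lee_fin le_eqVlt; apply/orP; left; apply/eqP.
  by field; rewrite gt_eqF.
rewrite -ge0_muleDr//.
have : 0 <= S1 + S2 by rewrite adde_ge0.
case: (S1 + S2) => [s| |]// _; last by rewrite leey.
by rewrite -EFinM -EFinD !lee_fin; nra.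
Qed.

End chi_square.

(** * Gaussian concentration *)

Section has_mean.
Context d0 (T : measurableType d0) (R : realType) (P : probability T R).
Local Open Scope ereal_scope.
Implicit Types f g : T -> R.

(** Integrability and a real value are kept together, so that expectations can be added and compared
    in [R], without [fine] or infinite cases. *)
Definition has_mean f (m : R) : Prop :=
  P.-integrable setT (EFin \o f) /\ \int[P]_x (f x)%:E = m%:E.

Lemma has_mean_measurable f m : has_mean f m -> measurable_fun setT f.
Proof. by move=> [/measurable_int/measurable_EFinP]. Qed.

Lemma has_mean_cst c : has_mean (cst c) c.
Proof.
split; first exact: finite_measure_integrable_cst.
by rewrite /cst integral_cst//= probability_setT mule1.
Qed.

Lemma has_meanD f g m n : has_mean f m -> has_mean g n ->
  has_mean (fun x => f x + g x)%R (m + n).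
Proof.
move=> [fi fE] [gi gE]; split.
  rewrite (_ : EFin \o _ = (EFin \o f) \+ (EFin \o g))//.
  exact: integrableD.
by under eq_integral do rewrite EFinD; rewrite integralD// fE gE.
Qed.

Lemma has_meanZ c f m : has_mean f m -> has_mean (fun x => c * f x)%R (c * m).
Proof.
move=> [fi fE]; split.
  rewrite (_ : EFin \o _ = fun x => c%:E * (EFin \o f) x)//.
  exact: integrableZl.
by under eq_integral do rewrite EFinM; rewrite integralZl// fE.
Qed.

Lemma has_mean_sum (I : Type) (s : seq I) (f : I -> T -> R) (m : I -> R) :
  (forall i, has_mean (f i) (m i)) ->
  has_mean (fun x => \sum_(i <- s) f i x)%R (\sum_(i <- s) m i)%R.
Proof.
move=> fm; elim: s => [|i s IHs].
  rewrite big_nil (_ : (fun _ => _) = cst 0%R); first exact: has_mean_cst.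
  by apply/funext => x; rewrite big_nil.
rewrite big_cons (_ : (fun _ => _) = fun x => f i x + \sum_(j <- s) f j x)%R.
  exact: has_meanD.
by apply/funext => x; rewrite big_cons.
Qed.

Lemma has_mean_le f g m n : has_mean f m -> has_mean g n ->
  (forall x, f x <= g x)%R -> (m <= n)%R.
Proof.
move=> [fi fE] [gi gE] fg; rewrite -lee_fin -fE -gE.
by apply: le_integral => // x _; rewrite lee_fin.
Qed.

Lemma integrable_has_mean f : P.-integrable setT (EFin \o f) ->
  has_mean f (fine (\int[P]_x (f x)%:E)).
Proof. by move=> fi; split=> //; rewrite fineK// integrable_fin_num. Qed.

Lemma dominated_has_mean f g m : measurable_fun setT f -> has_mean g m ->
  (forall x, `|f x| <= g x)%R -> has_mean f (fine (\int[P]_x (f x)%:E)).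
Proof.
move=> mf [gi _] fg; apply: integrable_has_mean.
apply: (le_integrable measurableT _ _ gi); first exact/measurable_EFinP.
move=> x _ /=; rewrite lee_fin; apply: le_trans (fg x) _; exact: ler_norm.
Qed.

(** Jensen's inequality, from the tangent of the exponential at [m]. *)
Lemma expR_mean_le f m : has_mean f m ->
  (expR m)%:E <= \int[P]_x (expR (f x))%:E.
Proof.
move=> fm; have mf := has_mean_measurable fm.
have mef : measurable_fun setT (fun x => (expR (f x))%:E).
  by apply/measurable_EFinP; exact: measurableT_comp.
have e0 : 0 <= \int[P]_x (expR (f x))%:E.
  by apply: integral_ge0 => x _; rewrite lee_fin expR_ge0.
have [foo|] := eqVneq (\int[P]_x (expR (f x))%:E) +oo; first by rewrite foo leey.
rewrite -ltey => fin.
have ei : P.-integrable setT (EFin \o (fun x => expR (f x))).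
  apply/integrableP; split => //.
  by under eq_integral do rewrite /= ger0_norm ?expR_ge0//.
have em := integrable_has_mean ei.
have := has_meanZ (expR m) (has_meanD (has_mean_cst (1 - m)) fm).
move=> /has_mean_le/(_ em); rewrite subrK mulr1 => h.
rewrite -[leRHS]fineK ?ge0_fin_numE// lee_fin; apply: h => x.
rewrite (_ : f x = m + (f x - m))%R; last by rewrite addrC subrK.
rewrite expRD ler_pM2l ?expR_gt0// (_ : _ + _ = 1 + (f x - m))%R ?expR_ge1Dx//.
by rewrite /cst; ring.
Qed.

End has_mean.

Section concentration.
Context {R : realType} {d : nat}.
Local Open Scope ereal_scope.
Notation gamma := (@std_gauss R d).

(** Infimum convolution with A = exp h and B = exp (- f), combined with Jensen for B. No regularity
    of [h] beyond measurability is required, which makes quadratic exponents accessible. *)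
Lemma std_gauss_exp_infconv (h f : 'rV[R]_d -> R) m : measurable_fun setT h ->
  has_mean gamma f m ->
  (forall x y, h x <= f y + dot (x - y) (x - y) / 4)%R ->
  \int[gamma]_x (expR (h x))%:E <= (expR m)%:E.
Proof.
move=> mh fm hf; have mf := has_mean_measurable fm.
have meh : measurable_fun setT (fun x => (expR (h x))%:E).
  by apply/measurable_EFinP; exact: measurableT_comp.
have mef : measurable_fun setT (fun x => (expR (- f x))%:E).
  apply/measurable_EFinP; apply: measurableT_comp => //.
  exact: measurableT_comp.
have nfm : has_mean gamma (fun x => - f x)%R (- m).
  have := has_meanZ (-1) fm; rewrite mulN1r.
  by under eq_fun do rewrite mulN1r.
have := @std_gauss_infconv R d (fun x => (expR (h x))%:E) (fun x => (expR (- f x))%:E).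
move=> /(_ meh mef (fun x => expR_ge0 _) (fun x => expR_ge0 _)) H.
have {}H : \int[gamma]_x (expR (h x))%:E * (expR (- m))%:E <= 1.
  apply: le_trans (H _); last first.
    move=> x y; rewrite -EFinM lee_fin -expRD ler_expR.
    by have := hf x y; lra.
  apply: lee_wpmul2l; last exact: expR_mean_le.
  by apply: integral_ge0 => x _; rewrite lee_fin expR_ge0.
have : 0 <= \int[gamma]_x (expR (h x))%:E.
  by apply: integral_ge0 => x _; rewrite lee_fin expR_ge0.
move: H; case: (\int[gamma]_x (expR (h x))%:E) => [r| |]//.
  by rewrite -EFinM !lee_fin expRN ler_pdivrMr ?expR_gt0// mul1r.
by rewrite gt0_mulye// lte_fin expR_gt0.
Qed.

(** Here [f] is [F] raised by [l ^+ 2], because [l * r <= l ^+ 2 + r ^+ 2 / 4]. *)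
Lemma std_gauss_exp_lipschitz (F : 'rV[R]_d -> R) (l m : R) :
  has_mean gamma F m -> (0 <= l)%R ->
  (forall x y, F x - F y <= enorm (x - y) * l)%R ->
  \int[gamma]_x (expR (F x))%:E <= (expR (m + l ^+ 2))%:E.
Proof.
move=> Fm l0 lip; apply: (std_gauss_exp_infconv (has_mean_measurable Fm)
  (has_meanD Fm (has_mean_cst gamma (l ^+ 2)))) => x y.
rewrite -sqr_enorm /cst; have := lip x y.
move: (F x) (F y) (enorm (x - y)) => a b r h.
by have := sqr_ge0 (l - r / 2); lra.
Qed.

End concentration.

(** * The projection of a Gaussian vector *)

(** Supplies rational upper bounds for the few numerical exponentials below, from 1 - x/n <= exp (-
    x/n). *)
Lemma expR_le_invXn {R : realType} (n : nat) (x : R) : x < n%:R ->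
  (0 < n)%N -> expR x <= (1 - x / n%:R)^-1 ^+ n.
Proof.
move=> xn n0; have nn : 0 < n%:R :> R by rewrite ltr0n.
have xn1 : 0 < 1 - x / n%:R by rewrite subr_gt0 ltr_pdivrMr// mul1r.
have -> : expR x = expR (x / n%:R) ^+ n.
  by rewrite -expRM_natl mulrC divfK// gt_eqF.
rewrite lerXn2r ?nnegrE ?expR_ge0 ?invr_ge0 ?(ltW xn1)//.
rewrite -[leLHS]invrK lef_pV2 ?posrE ?invr_gt0 ?expR_gt0// -expRN.
exact: expR_ge1Dx.
Qed.

(** Turns exponential moments of both signs into a variance bound. With y = z/2 the right side is 4
    (exp y - exp (- y))^2. *)
Lemma sqr_le_cosh {R : realType} (z : R) :
  z ^+ 2 <= 4 * (expR z + expR (- z) - 2).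
Proof.
wlog z0 : z / 0 <= z.
  move=> h; have [|z0] := leP 0 z; first exact: h.
  have := h (- z); rewrite opprK sqrrN (addrC (expR (- z))); apply.
  by rewrite oppr_ge0 ltW.
pose y := z / 2; have y0 : 0 <= y by rewrite divr_ge0.
have -> : z = y + y by rewrite /y; lra.
rewrite opprD !expRD.
have e1 : 1 + y <= expR y by exact: expR_ge1Dx.
have e2 : expR (- y) <= 1 by rewrite -expR0 ler_expR oppr_le0.
have e12 : expR y * expR (- y) = 1 by rewrite -expRD subrr expR0.
have h : y <= expR y - expR (- y) by lra.
have : y ^+ 2 <= (expR y - expR (- y)) ^+ 2.
  by rewrite ler_pXn2r// nnegrE ?(le_trans y0).
by move: (expR y) (expR (- y)) e12 => p q e12 {e1 e2 h}; nra.
Qed.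

Section projection_of_gaussian.
Context {R : realType} {d : nat}.
Variables (K : set 'rV[R]_d) (a : R).
Hypothesis coneK : pointed_cone K.
Local Notation gamma := (@std_gauss R d).
Hypothesis meanN : has_mean gamma (fun x => enorm (proj K x)) a.
Local Notation m := (mean_proj K).

Lemma measurable_proj : measurable_fun setT (proj K).
Proof.
apply: measurable_rVP => i; apply: measurable_continuous_rV.
exact: continuous_proj_coord.
Qed.

Lemma has_mean_proj_coord i :
  has_mean gamma (fun x => proj K x ord0 i) (m ord0 i).
Proof.
rewrite mxE unlock; apply: (dominated_has_mean _ meanN).
  exact: measurable_rV_coord measurable_proj.
by move=> x; exact: ler_coord_enorm.
Qed.

Lemma has_mean_dot_proj v : has_mean gamma (fun x => dot (proj K x) v) (dot m v).
Proof.
rewrite dotE (_ : (fun _ => _) =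
    fun x => \sum_i v ord0 i * proj K x ord0 i); last first.
  by apply/funext => x; rewrite dotE; apply: eq_bigr => i _; rewrite mulrC.
under [X in has_mean _ _ X]eq_bigr do rewrite mulrC.
apply: has_mean_sum => i; apply: has_meanZ; exact: has_mean_proj_coord.
Qed.

(** A barycentre argument through the projection: [m - proj K m] has nonpositive inner product with
    every point of [K], hence with their mean [m], and it is orthogonal to [proj K m]; so its
    squared norm is at most 0. *)
Lemma mean_proj_in : K m.
Proof.
suff -> : m = proj K m by exact: proj_in.
apply/eqP; rewrite -subr_eq0 -dot_eq0 eq_le dot_ge0 andbT.
have h : dot (m - proj K m) m <= 0.
  rewrite dotC.
  have := has_mean_le (has_mean_dot_proj (m - proj K m)) (has_mean_cst gamma 0).
  by apply => x; rewrite dotC; apply: dot_proj_le => //; exact: proj_in.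
by rewrite dotBr dot_proj// subr0.
Qed.

Lemma mean_ge0 : 0 <= a.
Proof.
by apply: (has_mean_le (has_mean_cst gamma 0) meanN) => x; exact: enorm_ge0.
Qed.

Lemma has_mean_exp_lipschitz (F : 'rV[R]_d -> R) (l b : R) :
  has_mean gamma F b -> 0 <= l ->
  (forall x y, F x - F y <= enorm (x - y) * l) ->
  exists2 c, has_mean gamma (fun x => expR (F x)) c & c <= expR (b + l ^+ 2).
Proof.
move=> Fb l0 lip; have := std_gauss_exp_lipschitz Fb l0 lip.
have mF := has_mean_measurable Fb => le.
have ei : gamma.-integrable setT (EFin \o (fun x => expR (F x))).
  apply/integrableP; split; first by apply/measurable_EFinP; exact: measurableT_comp.
  under eq_integral do rewrite /= ger0_norm ?expR_ge0//.
  by rewrite (le_lt_trans le)// ltry.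
have h := integrable_has_mean ei.
by eexists; [exact: h|]; rewrite -lee_fin; case: h => _ <-.
Qed.

Lemma enorm_proj_lipN x y :
  enorm (proj K x) - enorm (proj K y) <= enorm (x - y).
Proof. by apply: le_trans (ler_norm _) _; exact: enorm_proj_sub. Qed.

(** With N the norm of the projection, N^2 = 2 a N - a^2 + (N - a)^2, and the last square is bounded
    by [sqr_le_cosh]. Each of exp (N - a) and exp (a - N) has mean at most e <= 3, so the constant
    is 4 * 3 + 4 * 3 - 8 = 16. *)
Lemma has_mean_sqr_enorm_proj :
  exists2 b, has_mean gamma (fun x => enorm (proj K x) ^+ 2) b & b <= a ^+ 2 + 16.
Proof.
have [e1 he1 le1] := @has_mean_exp_lipschitz _ 1 _ meanN ler01
  (fun x y => eq_ind_r (fun r => _ <= r) (enorm_proj_lipN x y) (mulr1 _)).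
have negN : has_mean gamma (fun x => -1 * enorm (proj K x)) (-1 * a).
  exact: has_meanZ.
have [|e2 he2 le2] := @has_mean_exp_lipschitz _ 1 _ negN ler01.
  move=> x y; have := enorm_proj_lipN y x; rewrite enormB.
  by move: (enorm _) (enorm _) (enorm _) => p q r; lra.
have := has_meanD (has_meanD (has_meanZ (2 * a) meanN)
  (has_meanD (has_meanZ (4 * expR (- a)) he1) (has_meanZ (4 * expR a) he2)))
  (has_mean_cst gamma (- a ^+ 2 - 8)).
set g := fun x => _ => hg.
have Ng x : enorm (proj K x) ^+ 2 <= g x.
  rewrite /g mulN1r; have := sqr_le_cosh (enorm (proj K x) - a).
  rewrite opprB !expRD.
  move: (enorm _) (expR _) (expR (- a)) (expR _) (expR (- _)) => n p q r s.
  by rewrite /cst; nra.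
have mN2 : measurable_fun setT (fun x => enorm (proj K x) ^+ 2).
  by apply: measurable_funX; exact: has_mean_measurable meanN.
have hN2 := dominated_has_mean mN2 hg.
have {}hN2 := hN2 (fun x => eq_ind_r (fun r => r <= _) (Ng x) (ger0_norm (sqr_ge0 _))).
eexists; first exact: hN2.
apply: (le_trans (has_mean_le hN2 hg Ng)).
(* (6/5)^6 is about 2.986. *)
have e3 : expR 1 <= 3 :> R.
  apply: (le_trans (@expR_le_invXn _ 6 1 _ _)) => //; first by rewrite ltr1n.
  by rewrite (_ : 1 - 1 / 6%:R = 5 / 6 :> R) ?invf_div; lra.
have h1 : expR (- a) * e1 <= 3.
  apply: le_trans e3.
  have := ler_wpM2l (expR_ge0 (- a)) le1; rewrite -expRD.
  by rewrite (_ : - a + (a + 1 ^+ 2) = 1)//; ring.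
have h2 : expR a * e2 <= 3.
  apply: le_trans e3.
  have := ler_wpM2l (expR_ge0 a) le2; rewrite -expRD.
  by rewrite (_ : a + (-1 * a + 1 ^+ 2) = 1)//; ring.
by rewrite -!mulrA; move: (expR (- a) * e1) (expR a * e2) h1 h2 => u v; lra.
Qed.

(** Chernoff bound for the lower tail: [lam = a / 4] minimizes - lam a / 2 + lam^2, with value - a^2
    / 16 <= - 4 as soon as [a >= 8], and exp (- 4) <= 2^-4. *)
Lemma prob_enorm_proj_gt : 8 <= a ->
  exists2 p, gamma [set x | a / 2 < enorm (proj K x)] = p%:E & 15 / 16 <= p.
Proof.
move=> a8; pose lam := a / 4; have lam0 : 0 <= lam by rewrite divr_ge0// mean_ge0.
have := has_meanD (has_meanZ (- lam) meanN) (has_mean_cst gamma (lam * (a / 2))).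
set F := fun x => _ => hF.
have [|c hc lec] := @has_mean_exp_lipschitz F lam _ hF lam0.
  move=> x y; rewrite /F /cst; have := enorm_proj_lipN y x; rewrite (enormB y).
  move: (enorm _) (enorm _) (enorm _) => p q r h.
  by have := ler_wpM2r lam0 h; lra.
pose D := [set x | a / 2 < enorm (proj K x)].
have mN := has_mean_measurable meanN.
have mD : measurable D.
  rewrite /D -[X in measurable X]setTI.
  have /measurable_EFinP mN' := mN.
  exact: (emeasurable_fun_o_infty _ mN' (a / 2)%:E).
have fD : gamma D \is a fin_num by exact: fin_num_measure.
exists (fine (gamma D)); first by rewrite fineK.
have hD : has_mean gamma (\1_(~` D)) (1 - fine (gamma D)).
  have mDC : measurable (~` D) by exact: measurableC.
  split; first by apply: integrable_indic => //; rewrite fin_num_measure// ltey_eq.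
  rewrite integral_indic// setIT EFinB fineK//.
  exact: probability_setC.
have : 1 - fine (gamma D) <= c.
  apply: (has_mean_le hD hc) => x; rewrite indicE.
  have [|xD] := boolP (x \in ~` D); last exact: expR_ge0.
  rewrite inE /D/= => /negP; rewrite -leNgt => xD.
  rewrite -expR0 ler_expR /F /cst.
  have := ler_wpM2l lam0 xD.
  by move: (enorm _) => p; lra.
suff : expR (- lam * a + lam * (a / 2) + lam ^+ 2) <= 1 / 16 by lra.
have e2 : 2 <= expR 1 :> R by have := expR_ge1Dx (1 : R); lra.
have e16 : 16 <= expR 4 :> R.
  rewrite (_ : 4 = 4%:R * 1 :> R); last by rewrite mulr1.
  rewrite expRM_natl (_ : 16 = 2 ^+ 4 :> R); last by ring.
  by rewrite lerXn2r ?nnegrE ?expR_ge0.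
apply: (@le_trans _ _ (expR (- 4))).
  by rewrite ler_expR /lam; nra.
by rewrite expRN div1r lef_pV2 ?posrE ?expR_gt0.
Qed.

Lemma expR_dot_proj_le (t : R) : 8 <= a -> 0 <= t -> t * a <= 2 / 7 ->
  t * dot m m <= 2 / 7 ->
  (\int[gamma]_x \int[gamma]_y (expR (t * dot (proj K x) (proj K y)))%:E
    <= (expR (21 / 50))%:E)%E.
Proof.
move=> a8 t0 ta tm.
have [b hb leb] := has_mean_sqr_enorm_proj.
have t28 : t <= 1 / 28 by nra.
(* For fixed [x] the inner exponent is Lipschitz in [y] with constant t |Pi x| and mean t <m, Pi x>,
   so integrating over [y] leaves exp (h x). *)
pose h x := t * dot m (proj K x) + t ^+ 2 * enorm (proj K x) ^+ 2.
have mP := measurable_proj.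
have mh : measurable_fun setT h.
  apply: measurable_funD; apply: measurable_funM => //.
    by apply: measurable_dot => //; exact: measurable_cst.
  exact: has_mean_measurable hb.
have mint : measurable_fun setT (fun x => \int[gamma]_y
    (expR (t * dot (proj K x) (proj K y)))%:E)%E.
  apply: (measurable_fun_fubini_tonelli_F (m2 := gamma)
    (fun z => (expR (t * dot (proj K z.1) (proj K z.2)))%:E)).
    apply/measurable_EFinP; apply: measurableT_comp => //.
    apply: measurable_funM => //; apply: measurable_dot.
      exact: (measurableT_comp mP).
    exact: (measurableT_comp mP).
  by move=> z; rewrite lee_fin expR_ge0.
apply: (@le_trans _ _ (\int[gamma]_x (expR (h x))%:E)%E).
  apply: ge0_le_integral => //.
  - by move=> x _; apply: integral_ge0 => y _; rewrite lee_fin expR_ge0.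
  - by apply/measurable_EFinP; exact: measurableT_comp.
  move=> x _.
  have hx : h x = t * dot m (proj K x) + (t * enorm (proj K x)) ^+ 2.
    by rewrite /h exprMn.
  under eq_integral do rewrite (dotC (proj K x)).
  rewrite hx; apply: (std_gauss_exp_lipschitz
    (has_meanZ t (has_mean_dot_proj (proj K x)))).
    by rewrite mulr_ge0 ?enorm_ge0.
  move=> y z; rewrite -mulrBr mulrCA ler_wpM2l//.
  by apply: le_trans (ler_norm _) _; exact: dot_proj_lip.
(* The function compared with [h]: the same linear and quadratic terms, plus 9/4 t^2 |m|^2 and 9 t^4
   |Pi y|^2, which complete the two squares [s1] and [s2] below. *)
have hf := has_meanD (has_meanZ t (has_mean_dot_proj m))
  (has_meanD (has_mean_cst gamma (9 / 4 * t ^+ 2 * dot m m))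
    (has_meanZ (t ^+ 2 + 9 * t ^+ 4) hb)).
have := std_gauss_exp_infconv mh hf; set g := (X in expR X).
(* Since t <= 1/28 and t^2 b <= 4/49 + 16/784 = 5/49, the terms add up to about 0.412. *)
have gle : g <= 21 / 50.
  rewrite /g; move: (dot m m) tm => M tm.
  have t2a : t ^+ 2 * a ^+ 2 <= 4 / 49.
    rewrite -exprMn (_ : 4 / 49 = (2 / 7) ^+ 2); last by lra.
    by rewrite lerXn2r ?nnegrE// mulr_ge0// mean_ge0.
  have t2 : t ^+ 2 <= 1 / 784 by nra.
  have t20 : 0 <= t ^+ 2 by exact: sqr_ge0.
  have t2b : t ^+ 2 * b <= 5 / 49 by have := ler_wpM2l t20 leb; lra.
  have -> : t * M + (9 / 4 * t ^+ 2 * M + (t ^+ 2 + 9 * t ^+ 4) * b) =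
    t * M + 9 / 4 * (t * (t * M)) + (t ^+ 2 * b + 9 * (t ^+ 2 * (t ^+ 2 * b))).
    by ring.
  have : t * (t * M) <= t * (2 / 7) by rewrite ler_wpM2l.
  have : t ^+ 2 * (t ^+ 2 * b) <= t ^+ 2 * (5 / 49) by rewrite ler_wpM2l.
  by lra.
move=> H; apply: (le_trans (H _)); last by rewrite lee_fin ler_expR.
move=> x y; rewrite /h /cst -!sqr_enorm.
have := enorm_proj_lipN x y; have := dot_proj_lip coneK m x y.
move=> /(le_trans (ler_norm _)).
rewrite (dotC m).
move: (dot (proj K x) m) (dot (proj K y) m) (enorm_ge0 m) (enorm_ge0 (proj K x))
  (enorm_ge0 (proj K y))
  (enorm_ge0 (x - y)).
move: (enorm m) (enorm (proj K x)) (enorm (proj K y)) (enorm (x - y)).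
move=> M n1 n2 r p q M0 n10 n20 r0 pq n12.
(* The cost r^2 / 4 is spent as 1/9 + 1/9 + 1/36: one share for the linear term, one for the cross
   term 2 t^2 |Pi y| r, and one for t^2 r^2. *)
have s1 := sqr_ge0 (r / 3 - 3 / 2 * (t * M)).
have s2 := sqr_ge0 (r / 3 - 3 * (t ^+ 2 * n2)).
have t20 : 0 <= t ^+ 2 by exact: sqr_ge0.
have tpq : t * (p - q) <= t * (r * M) by rewrite ler_wpM2l.
have n1s : n1 ^+ 2 <= (n2 + r) ^+ 2.
  by rewrite lerXn2r ?nnegrE ?addr_ge0//; lra.
have tn1 := ler_wpM2l t20 n1s.
have t2 : t ^+ 2 <= 1 / 36 by nra.
have tr := ler_wpM2r (sqr_ge0 r) t2.
by move: s1 s2 tpq tn1 tr; clear; lra.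
Qed.

End projection_of_gaussian.

(** * The lower bound *)

Section lower_bound.
Context {R : realType} {d : nat}.
Variables (sigma eps : R) (C1 C2 : set 'rV[R]_d).
Hypotheses (sigma0 : 0 < sigma) (eps0 : 0 < eps).
Hypotheses (coneC1 : closed_convex_cone C1) (coneC2 : closed_convex_cone C2).
Local Notation K := (C2 `&` polar C1).
Local Notation gamma := (@std_gauss R d).
Local Notation a := (mean_norm_proj K).
Local Notation m := (mean_proj K).

Let C10 : C1 0.
Proof. by have [] := closed_convex_cone_pointed coneC1. Qed.

Let coneK : pointed_cone K.
Proof. exact: pointed_cone_polarI (closed_convex_cone_pointed coneC2). Qed.

Lemma polar_alternative u : K u -> eps < enorm u -> (C2 `\` tube C1 eps) u.
Proof.
move=> [C2u Pu] epsu; split => //.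
by rewrite /tube/= dist_to_polar// leNgt epsu.
Qed.

(** [fine] sends [+oo] to 0, so a nonzero value certifies that the expectation is finite. *)
Lemma has_mean_norm_proj : a != 0 ->
  has_mean gamma (fun x => enorm (proj K x)) a.
Proof.
rewrite /mean_norm_proj unlock => a0; apply: integrable_has_mean.
have mN : measurable_fun setT (fun x => enorm (proj K x)).
  apply: measurable_continuous_rV; apply: lipschitz_continuous.
  exact: enorm_proj_sub.
apply/integrableP; split; first exact/measurable_EFinP.
under eq_integral do rewrite /= ger0_norm ?enorm_ge0//.
move: a0; have : (0 <= \int[gamma]_x (enorm (proj K x))%:E)%E.
  by apply: integral_ge0 => x _; rewrite lee_fin enorm_ge0.
by case: (\int[gamma]_x _)%E => //= [r|]; rewrite ?ltry ?eqxx.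
Qed.

Hypothesis small :
  ((eps ^+ 2)%:E <= ((1 / 14%:R) * sigma ^+ 2)%:E * delta_opt2 C1 C2)%E.

Let c0 : 0 <= 1 / 14%:R * sigma ^+ 2.
Proof. by rewrite mulr_ge0 ?sqr_ge0. Qed.

Lemma eps_le_mean : eps ^+ 2 <= 1 / 14 * sigma ^+ 2 * a.
Proof.
rewrite -lee_fin [leRHS]EFinM; apply: (le_trans small).
apply: lee_wpmul2l; first by rewrite lee_fin c0.
by rewrite /delta_opt2 ge_min lexx.
Qed.

Lemma mean_gt0 : 0 < a.
Proof.
rewrite ltNge; apply/negP => a0.
have e2 : 0 < eps ^+ 2 by rewrite exprn_gt0.
have := eps_le_mean; have := mulr_ge0_le0 c0 a0; lra.
Qed.

Let meanN : has_mean gamma (fun x => enorm (proj K x)) a.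
Proof. by apply: has_mean_norm_proj; rewrite gt_eqF// mean_gt0. Qed.

Lemma enorm_mean_proj_le : m != 0 ->
  enorm m <= sup [set dot eta m | eta in K `&` unit_sphere].
Proof.
move=> m0; have mm0 : 0 < enorm m by rewrite lt_def enorm_eq0 m0 enorm_ge0.
have Km : K m := mean_proj_in coneK meanN.
apply: ub_le_sup.
  exists (enorm m) => _ [eta [_ eta1] <-].
  by rewrite (le_trans (cauchy_schwarz _ _))// eta1 mul1r.
exists ((enorm m)^-1 *: m).
  split; first by have [_ _ _ KZ] := coneK; apply: KZ => //; rewrite invr_ge0 ltW.
  by rewrite /unit_sphere/= enormZ ger0_norm ?invr_ge0 ?(ltW mm0)// mulVf// gt_eqF.
by rewrite dotZl -sqr_enorm expr2 mulrA mulVf ?mul1r// gt_eqF.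
Qed.

(** Clearing the denominator makes [m = 0] trivial; for [m != 0] the supremum is at least |m| > 0,
    which selects the finite branch of [delta_opt2]. *)
Lemma eps_mean_proj_le : eps ^+ 2 * dot m m <= 1 / 14 * sigma ^+ 2 * a ^+ 2.
Proof.
have [->|m0] := eqVneq m 0.
  by rewrite dot0l mulr0 mulr_ge0 ?sqr_ge0.
have ms := enorm_mean_proj_le m0.
have mm0 : 0 < enorm m by rewrite lt_def enorm_eq0 m0 enorm_ge0.
move: ms; set s := sup _ => ms.
have s0 : 0 < s by exact: lt_le_trans ms.
have : eps ^+ 2 <= 1 / 14 * sigma ^+ 2 * (a / s) ^+ 2.
  rewrite -lee_fin [leRHS]EFinM; apply: (le_trans small).
  apply: lee_wpmul2l; first by rewrite lee_fin c0.
  by rewrite /delta_opt2 -/s gt_eqF// ge_min lexx orbT.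
rewrite expr_div_n mulrA ler_pdivlMr ?exprn_gt0// => h.
apply: le_trans h; rewrite -sqr_enorm ler_wpM2l ?sqr_ge0//.
by rewrite ler_pXn2r// nnegrE ltW.
Qed.

Lemma error_ge_half_small (psi : 'rV[R]_d -> bool) : a <= 8 ->
  measurable_fun setT psi ->
  ((1 / 2)%:E <= uniform_error sigma psi C1 C2 eps)%E.
Proof.
move=> a8 mpsi.
have [x Px] : exists x, proj K x != 0.
  apply: contrapT => /forallNP P0; have := mean_gt0.
  have -> : a = 0; last by rewrite ltxx.
  apply/eqP; rewrite eq_le (mean_ge0 meanN) andbT.
  apply: (has_mean_le meanN (has_mean_cst gamma 0)) => x.
  by have /negP/negPn/eqP -> := P0 x; rewrite enorm0.
have N0 : 0 < enorm (proj K x) by rewrite lt_def enorm_eq0 Px enorm_ge0.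
(* The value 3/5 lies between 8/14, so that [sigma *: u] is an admissible alternative, and log 2, so
   that the second moment stays below 2. *)
pose c : R := Num.sqrt (3 / 5).
have c2 : c ^+ 2 = 3 / 5 by rewrite sqr_sqrtr.
pose u : 'rV[R]_d := (c / enorm (proj K x)) *: proj K x.
have u2 : enorm u = c.
  rewrite enormZ ger0_norm ?divr_ge0 ?enorm_ge0 ?sqrtr_ge0//.
  by rewrite divfK// gt_eqF.
apply: (@chi_square_bound _ _ sigma eps 1 C1 C2 setT (cst u)) => //.
- by rewrite probability_setT.
- move=> y _; rewrite /cst; apply: polar_alternative.
    have [_ _ _ KZ] := coneK; apply: (KZ); first exact: ltW.
    apply: (KZ); last exact: proj_in.
    by rewrite divr_ge0 ?enorm_ge0 ?sqrtr_ge0.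
  rewrite enormZ u2 ger0_norm ?(ltW sigma0)//.
  rewrite -(@ltr_pXn2r _ 2)// ?nnegrE ?mulr_ge0 ?sqrtr_ge0 ?(ltW sigma0) ?(ltW eps0)//.
  have s2 : 0 < sigma ^+ 2 by rewrite exprn_gt0.
  rewrite exprMn c2; have := eps_le_mean; have := ler_wpM2l (ltW s2) a8; lra.
- have intc (r : R) : (\int[gamma]_x r%:E = r%:E)%E := (has_mean_cst gamma r).2.
  under eq_integral do under eq_integral do
    rewrite !indicT !mul1r -sqr_enorm u2 c2.
  under eq_integral do rewrite intc.
  rewrite intc lee_fin expr1n mulr1.
  apply: (le_trans (@expR_le_invXn _ 8 _ _ _)) => //; first by lra.
  rewrite (_ : 1 - 3 / 5 / 8%:R = 37 / 40); last by lra.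
  by rewrite invf_div; lra.
Qed.

Lemma error_ge_half_large (psi : 'rV[R]_d -> bool) : 8 <= a ->
  measurable_fun setT psi ->
  ((1 / 2)%:E <= uniform_error sigma psi C1 C2 eps)%E.
Proof.
move=> a8 mpsi; have a0 := mean_gt0.
(* This scale makes norm [a / 2], the boundary of the conditioning event, correspond exactly to
   distance [eps]. *)
have [tau [tau0 tau2 epsE]] : exists tau : R, [/\ 0 < tau,
    tau ^+ 2 * (sigma ^+ 2 * a ^+ 2) = 4 * eps ^+ 2 & eps = sigma * tau * (a / 2)].
  exists (2 * eps / (sigma * a)); split.
  - by rewrite divr_gt0 ?mulr_gt0.
  - by field; rewrite !gt_eqF.
  - by field; rewrite !gt_eqF.
have sa : 0 < sigma ^+ 2 * a by rewrite mulr_gt0 ?exprn_gt0.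
have saa : 0 < sigma ^+ 2 * a ^+ 2 by rewrite mulr_gt0 ?exprn_gt0.
have [p gp p1516] := prob_enorm_proj_gt coneK meanN a8.
have mP := measurable_proj coneK.
have mN := has_mean_measurable meanN.
pose D := [set x | a / 2 < enorm (proj K x)].
have mD : measurable D.
  rewrite /D -[X in measurable X]setTI.
  have /measurable_EFinP mN' := mN.
  exact: (emeasurable_fun_o_infty _ mN' (a / 2)%:E).
apply: (@chi_square_bound _ _ sigma eps p C1 C2 D (fun x => tau *: proj K x)) => //.
- by lra.
- exact: measurable_rV_scale.
- move=> x Dx; apply: polar_alternative.
    have [_ _ _ KZ] := coneK; apply: (KZ); first exact: ltW.
    by apply: (KZ); [exact: ltW|exact: proj_in].
  rewrite scalerA enormZ ger0_norm ?mulr_ge0 ?(ltW sigma0) ?(ltW tau0)//.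
  by rewrite [ltLHS]epsE ltr_pM2l ?mulr_gt0//; exact: Dx.
(* Conditioning is dropped from the second moment, as indicators are at most 1; it survives only in
   the factor [p ^+ 2] on the right. *)
apply: (@le_trans _ _ (\int[gamma]_x \int[gamma]_y
    (expR (tau ^+ 2 * dot (proj K x) (proj K y)))%:E)%E).
  have mk : measurable_fun setT (fun z : 'rV[R]_d * 'rV[R]_d =>
      dot (proj K z.1) (proj K z.2)).
    by apply: measurable_dot; exact: (measurableT_comp mP).
  have me2 : measurable_fun setT (fun z : 'rV[R]_d * 'rV[R]_d =>
      (expR (tau ^+ 2 * dot (proj K z.1) (proj K z.2)))%:E).
    apply/measurable_EFinP; apply: measurableT_comp => //.
    exact: measurable_funM.
  have m1D : measurable_fun setT (\1_D : 'rV[R]_d -> R) by exact: measurable_indic.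
  have me1 : measurable_fun setT (fun z : 'rV[R]_d * 'rV[R]_d =>
      (\1_D z.1 * \1_D z.2 *
        expR (dot (tau *: proj K z.1) (tau *: proj K z.2)))%:E).
    apply/measurable_EFinP; apply: measurable_funM.
      by apply: measurable_funM; exact: (measurableT_comp m1D).
    apply: measurableT_comp => //; apply: measurable_dot;
      apply: measurable_rV_scale; exact: (measurableT_comp mP).
  have ind0 x y : 0 <= \1_D x * \1_D y * expR (dot (tau *: proj K x) (tau *: proj K y)).
    by rewrite mulr_ge0 ?expR_ge0// !indicE mulr_ge0.
  apply: ge0_le_integral => //.
  - by move=> x _; apply: integral_ge0 => y _; rewrite lee_fin.
  - apply: (measurable_fun_fubini_tonelli_F (m2 := gamma) _ me1) => z.
    by rewrite lee_fin.
  - apply: (measurable_fun_fubini_tonelli_F (m2 := gamma) _ me2) => z.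
    by rewrite lee_fin expR_ge0.
  move=> x _; apply: ge0_le_integral => //.
  - exact: (measurableT_comp me1 (pair1_measurable x)).
  - exact: (measurableT_comp me2 (pair1_measurable x)).
  move=> y _; rewrite lee_fin dotZl dotZr mulrA -expr2 -[leRHS]mul1r.
  by rewrite ler_wpM2r ?expR_ge0// !indicE mulr_ile1.
apply: (le_trans (expR_dot_proj_le coneK meanN a8 _ _ _)).
- exact: sqr_ge0.
- rewrite -(ler_pM2r sa) (_ : _ * a * _ = tau ^+ 2 * (sigma ^+ 2 * a ^+ 2)).
    by rewrite tau2; have := eps_le_mean; lra.
  by ring.
- rewrite -(ler_pM2r saa)
    (_ : tau ^+ 2 * _ * _ = tau ^+ 2 * (sigma ^+ 2 * a ^+ 2) * dot m m).
    by rewrite tau2; have := eps_mean_proj_le; lra.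
  by ring.
(* Numerically (200/179)^4 is about 1.56, against 2 (15/16)^2, about 1.76. *)
rewrite lee_fin; apply: (le_trans (@expR_le_invXn _ 4 _ _ _)) => //; first by lra.
rewrite (_ : 1 - 21 / 50 / 4%:R = 179 / 200); last by lra.
have : (15 / 16) ^+ 2 <= p ^+ 2 by rewrite lerXn2r ?nnegrE; lra.
by rewrite invf_div; lra.
Qed.

Lemma minimax_error_ge_half : ((1 / 2)%:E <= minimax_error sigma C1 C2 eps)%E.
Proof.
apply: le_ereal_inf_tmp => _ [psi mpsi <-].
by have [|/ltW] := leP a 8; [move/error_ge_half_small|move/error_ge_half_large]; apply.
Qed.

End lower_bound.

Theorem theorem2 (R : realType) :
  (exists2 kappa : R -> R,
    (forall rho : R, 0 < rho <= 1 / 2%:R -> 0 < kappa rho) &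
    forall (d : nat) (sigma : R) (C1 C2 : set 'rV[R]_d) (rho eps : R),
      (0 < d)%N -> 0 < sigma ->
      closed_convex_cone C1 -> closed_convex_cone C2 ->
      C1 `<=` C2 -> C1 <> C2 -> non_oblique C1 C2 ->
      0 < rho <= 1 / 2%:R ->
      0 < eps ->
      ((eps ^+ 2)%:E <= (kappa rho * sigma ^+ 2)%:E * delta_opt2 C1 C2)%E ->
      (rho%:E <= minimax_error sigma C1 C2 eps)%E)
  /\
  (forall (d : nat) (sigma : R) (C1 C2 : set 'rV[R]_d) (rho eps : R),
     (0 < d)%N -> 0 < sigma ->
     closed_convex_cone C1 -> closed_convex_cone C2 ->
     C1 `<=` C2 -> C1 <> C2 -> non_oblique C1 C2 ->
     0 < rho <= 1 / 2%:R ->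
     0 < eps ->
     ((eps ^+ 2)%:E <= ((1 / 14%:R) * sigma ^+ 2)%:E * delta_opt2 C1 C2)%E ->
     (rho%:E <= minimax_error sigma C1 C2 eps)%E).
Proof.
suff main : forall (d : nat) (sigma : R) (C1 C2 : set 'rV[R]_d) (rho eps : R),
     (0 < d)%N -> 0 < sigma ->
     closed_convex_cone C1 -> closed_convex_cone C2 ->
     C1 `<=` C2 -> C1 <> C2 -> non_oblique C1 C2 ->
     0 < rho <= 1 / 2%:R ->
     0 < eps ->
     ((eps ^+ 2)%:E <= ((1 / 14%:R) * sigma ^+ 2)%:E * delta_opt2 C1 C2)%E ->
     (rho%:E <= minimax_error sigma C1 C2 eps)%E.
  split => //; exists (fun=> 1 / 14%:R) => // rho _; exact: divr_gt0.
move=> d sigma C1 C2 rho eps _ sigma0 cC1 cC2 _ _ _ /andP[_ rho2] eps0 small.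
(* The bound 1/2 covers every admissible [rho] at once. *)
apply: (@le_trans _ _ (1 / 2)%:E); first by rewrite lee_fin.
exact: minimax_error_ge_half.
Qed.
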